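(* Given a stopping one-player tree-like rotor game on a simple graph with vertex set $V$ and with arbitrary (nonnegative) integer sink values, and given a starting vertex $u_0$, one can compute the value $\mathrm{val}^*(u_0)$ of the game in linear time $O(|V|)$.
   Context: A directed graph $(V,\mathcal{A},h,t)$ has a finite vertex set $V$, a finite arc set $\mathcal{A}$, and maps $h,t:\mathcal{A}\to V$ (head, tail), with no loops. $\mathcal{A}^+(u)$ is the set of arcs with tail $u$. It is simple if for every $u,v$ there is at most one arc with tail $u$ and head $v$. $\overline{G}$ is the simple undirected graph on $V$ in which $u,v$ are adjacent iff some arc joins them in either direction. Rotor graph $(V_0,S_0,\mathcal{A},h,t,\theta)$: $V=V_0\sqcup S_0$ with $S_0\neq\emptyset$ (the sinks), and for each $u\in V_0$ a rotor order $\theta_u:\mathcal{A}^+(u)\to\mathcal{A}^+(u)$ such that the orbit of every arc is all of $\mathcal{A}^+(u)$. A rotor configuration is a map $\rho:V_0\to\mathcal{A}$ with $\rho(u)\in\mathcal{A}^+(u)$; a partial configuration on $V'\subseteq V_0$ is such a map defined on $V'$ only. One routing step from $(\rho,u)$, $u\in V_0$: the particle moves from $u$ to $h(\rho(u))$, and then $\rho(u)$ is replaced by $\theta_u(\rho(u))$. The maximal rotor walk iterates routing steps until a sink is reached. The rotor graph is stopping if from every vertex there is a directed path to a sink (then all rotor walks are finite). It is tree-like if $\overline{G}$ is a tree and every sink is a leaf of $\overline{G}$. One-player tree-like rotor game $(V_r,V_{\mathcal{MAX}},S_0,\mathcal{A},h,t,\theta,\mathrm{val},\rho)$: $V_r,V_{\mathcal{MAX}},S_0$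 are disjoint, $(V_0,S_0,\mathcal{A},h,t,\theta)$ with $V_0=V_r\cup V_{\mathcal{MAX}}$ is a tree-like rotor graph, $\mathrm{val}:S_0\to\mathbb{N}$, and $\rho$ is a partial configuration on $V_r$. It is stopping if the rotor graph is. A strategy $\sigma$ is a partial configuration on $V_{\mathcal{MAX}}$. For a starting vertex $u_0$, $\mathrm{val}_\sigma(u_0)=\mathrm{val}(s)$ where $s$ is the sink reached by the maximal rotor walk from $((\rho,\sigma),u_0)$, and $\mathrm{val}^*(u_0)=\max_\sigma\mathrm{val}_\sigma(u_0)$. Time is counted in elementary operations (arithmetic operations and comparisons at unit cost). *)

(* Defs.v *)
From mathcomp Require Import all_boot.

Set Implicit Arguments.
Unset Strict Implicit.
Unset Printing Implicit Defensive.

(** * Rotor graphs *)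

Record digraph (V A : finType) := Digraph {
  arc_head : A -> V;
  arc_tail : A -> V;
  no_loop : forall a : A, arc_head a != arc_tail a
}.

Definition out_arcs (V A : finType) (G : digraph V A) (u : V) : {set A} :=
  [set a | arc_tail G a == u].

Definition simple (V A : finType) (G : digraph V A) : Prop :=
  forall a b : A,
    arc_tail G a = arc_tail G b -> arc_head G a = arc_head G b -> a = b.

Definition arc_rel (V A : finType) (G : digraph V A) : rel V :=
  fun u v => [exists a, (arc_tail G a == u) && (arc_head G a == v)].

(* Adjacency in the underlying simple undirected graph. *)
Definition adj (V A : finType) (G : digraph V A) : rel V :=
  fun u v => arc_rel G u v || arc_rel G v u.

(* Nonemptiness of the vertex set is not repeated here: rotor graphs have at
   least one sink. *)
Definition is_tree (V : finType) (e : rel V) : Prop :=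
  (forall u v : V, connect e u v) /\
  (forall c : seq V, 2 < size c -> ~ ucycle e c).

Definition is_leaf (V : finType) (e : rel V) (u : V) : Prop :=
  #|[set v | e u v]| = 1.

(* [V_0] is the complement of [sinks].  The sets of outgoing arcs of distinct
   vertices are disjoint, so the family of rotor orders is given by one map
   [theta]; its values on arcs whose tail is a sink are irrelevant. *)
Record rotor_graph (V A : finType) := RotorGraph {
  rg_graph :> digraph V A;
  sinks : {set V};
  theta : A -> A;
  sinks_neq0 : sinks != set0;
  theta_orbit : forall a : A, arc_tail rg_graph a \notin sinks ->
    orbit theta a =i out_arcs rg_graph (arc_tail rg_graph a)
}.

Definition stopping (V A : finType) (G : rotor_graph V A) : Prop :=
  forall u : V, exists2 s : V, s \in sinks G & connect (arc_rel G) u s.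

Definition tree_like (V A : finType) (G : rotor_graph V A) : Prop :=
  is_tree (adj G) /\ (forall s : V, s \in sinks G -> is_leaf (adj G) s).

(* A partial configuration on [W] is represented by a total map, of which only
   the values on [W] are meaningful. *)
Definition partial_config (V A : finType) (G : digraph V A) (W : {set V})
    (r : {ffun V -> A}) : bool :=
  [forall u in W, r u \in out_arcs G u].

(* Routing step on a pair (configuration, position of the particle).  States
   whose particle is on a sink are made stationary, so that the maximal rotor
   walk is the sequence of iterates up to the first one on a sink. *)
Definition routing_step (V A : finType) (G : rotor_graph V A)
    (c : {ffun V -> A} * V) : {ffun V -> A} * V :=
  let: (r, u) := c in
  if u \in sinks G then (r, u)
  else ([ffun v => if v == u then theta G (r u) else r v], arc_head G (r u)).

(* [None] when the maximal rotor walk is infinite. *)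
Definition sink_reached (V A : finType) (G : rotor_graph V A)
    (r : {ffun V -> A}) (u : V) : option V :=
  [pick s in sinks G |
    [exists r', fconnect (routing_step G) (r, u) (r', s)]].

(** * One-player rotor games *)

(* [sink_val] is meaningful on [sinks] only, and [rho] on [randv] only. *)
Record game (V A : finType) := Game {
  g_rotor :> rotor_graph V A;
  maxv : {set V};
  sink_val : V -> nat;
  rho : {ffun V -> A};
  maxv_not_sink : [disjoint maxv & sinks g_rotor];
  rho_config : partial_config g_rotor (~: (maxv :|: sinks g_rotor)) rho
}.

(* The set [V_r]. *)
Definition randv (V A : finType) (G : game V A) : {set V} :=
  ~: (maxv G :|: sinks G).

Definition strategy (V A : finType) (G : game V A) : pred {ffun V -> A} :=
  fun sigma => partial_config G (maxv G) sigma.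

Definition join_config (V A : finType) (G : game V A)
    (sigma : {ffun V -> A}) : {ffun V -> A} :=
  [ffun u => if u \in maxv G then sigma u else rho G u].

(* The default value 0 is never used when the game is stopping. *)
Definition val_strategy (V A : finType) (G : game V A)
    (sigma : {ffun V -> A}) (u0 : V) : nat :=
  if sink_reached G (join_config G sigma) u0 is Some s
  then sink_val G s else 0.

Definition val_star (V A : finType) (G : game V A) (u0 : V) : nat :=
  \max_(sigma : {ffun V -> A} | strategy G sigma) val_strategy G sigma u0.

(** * Unit-cost random-access machine *)

(* Programs are structured, and the memory consists of infinite arrays of
   natural numbers; [m x i] is the content of cell [i] of array [x].  A program
   names only finitely many arrays (names cannot be computed), so that up to a
   constant factor in time this is the RAM with a single array. *)
Definition memory := nat -> nat -> nat.

Definition update (m : memory) (x i v : nat) : memory :=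
  fun y j => if (y == x) && (j == i) then v else m y j.

Inductive binop := Add | Sub | Mul | Div | Eq | Leq.

Inductive expr :=
  | Const of nat
  | Read of nat & expr
  | Bin of binop & expr & expr.

Inductive cmd :=
  | Skip
  | Store of nat & expr & expr
  | Seq of cmd & cmd
  | If of expr & cmd & cmd
  | While of expr & cmd.

(* [Sub] is truncated at 0, division by 0 gives 0. *)
Definition eval_binop (o : binop) (p q : nat) : nat :=
  match o with
  | Add => p + q
  | Sub => p - q
  | Mul => p * q
  | Div => p %/ q
  | Eq => p == q
  | Leq => p <= q
  end.

Fixpoint eval (m : memory) (e : expr) : nat :=
  match e with
  | Const k => k
  | Read x i => m x (eval m i)
  | Bin o e1 e2 => eval_binop o (eval m e1) (eval m e2)
  end.

Fixpoint cost (e : expr) : nat :=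
  match e with
  | Const _ => 1
  | Read _ i => (cost i).+1
  | Bin _ e1 e2 => (cost e1 + cost e2).+1
  end.

(* [exec c m t m']: started on memory [m], the program [c] halts after [t]
   elementary operations with memory [m'].  Tests succeed on nonzero values. *)
Inductive exec : cmd -> memory -> nat -> memory -> Prop :=
  | ExecSkip m : exec Skip m 1 m
  | ExecStore x i e m :
      exec (Store x i e) m (cost i + cost e).+1
           (update m x (eval m i) (eval m e))
  | ExecSeq c1 c2 m1 m2 m3 t1 t2 :
      exec c1 m1 t1 m2 -> exec c2 m2 t2 m3 ->
      exec (Seq c1 c2) m1 (t1 + t2) m3
  | ExecIfTrue e c1 c2 m m' t :
      eval m e != 0 -> exec c1 m t m' ->
      exec (If e c1 c2) m (cost e + t).+1 m'
  | ExecIfFalse e c1 c2 m m' t :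
      eval m e = 0 -> exec c2 m t m' ->
      exec (If e c1 c2) m (cost e + t).+1 m'
  | ExecWhileTrue e c m1 m2 m3 t1 t2 :
      eval m1 e != 0 -> exec c m1 t1 m2 -> exec (While e c) m2 t2 m3 ->
      exec (While e c) m1 (cost e + t1 + t2).+1 m3
  | ExecWhileFalse e c m :
      eval m e = 0 -> exec (While e c) m (cost e).+1 m.

Definition table (T : finType) (f : T -> nat) (i : nat) : nat :=
  nth 0 [seq f x | x <- enum T] i.

(* Vertices and arcs are numbered by [enum_rank]; since the structures on [V]
   and [A] are arbitrary, so is the numbering. *)
Definition code (T : finType) (x : T) : nat := enum_rank x.

(* 0, 1, 2 for [V_r], [V_MAX] and the sinks, respectively. *)
Definition vertex_kind (V A : finType) (G : game V A) (u : V) : nat :=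
  if u \in sinks G then 2 else if u \in maxv G then 1 else 0.

(* The input is the tuple defining the game, component by component, with the
   starting vertex.  Entries at which a component is undefined are 0, and so is
   all the rest of the memory. *)
Definition encode (V A : finType) (G : game V A) (u0 : V) : memory :=
  fun x => match x with
  | 0 => nth 0 [:: #|V|; #|A|; code u0]
  | 1 => table (fun a : A => code (arc_tail G a))
  | 2 => table (fun a : A => code (arc_head G a))
  | 3 => table (fun a : A =>
           if arc_tail G a \in sinks G then 0 else code (theta G a))
  | 4 => table (vertex_kind G)
  | 5 => table (fun u => if u \in sinks G then sink_val G u else 0)
  | 6 => table (fun u => if u \in randv G then code (rho G u) else 0)
  | _ => fun=> 0
  end.

Definition output (m : memory) : nat := m 7 0.

(* Main.v *)
(* Root the tree at [u0] and count the crossings of every edge.  A subtree is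
   entered and left only through the edge to the parent of its root, so at any
   time the number of entries minus the number of returns is 1 if the particle is
   inside and 0 otherwise.  The rotor order makes the numbers of uses of two arcs
   with the same tail differ by at most 1, in favour of the one that comes first.
   These two facts give, bottom up, a tight bound [F w] on the number of returns
   from a vertex [w] to its parent and, top down from [B u0 = 1], a bound [B x] on
   the number of entries into [x] when the final sink is below [x]; each bound is a
   minimum over the neighbours.  A sink [s] can be reached if and only if
   [0 < B s]: the strategy that points to the next vertex on the path from [u0] to
   [s] where there is one, and to the parent elsewhere, then ends in [s].
   In these recursions [#|V|] stands for an infinite bound, which is harmless
   because budgets lose at most 1 per level of the tree.
   The program finds the tree by a breadth-first search from [u0], computes [F]
   backwards and [B] forwards along the queue, and takes the largest value of a
   sink with a positive budget. *)
Require Import Defs.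
From mathcomp Require Import all_boot.
From mathcomp Require Import zify.

Set Implicit Arguments.
Unset Strict Implicit.
Unset Printing Implicit Defensive.

(** * Rooted trees *)

(** A strategy only decides which arc of a cyclic rotor order comes first, so at a vertex of V_MAX
    two arcs are comparable up to 1 in either direction; the strategy aimed at [s] realises the
    favourable side of each comparison. For the walk argument the recursions are split into
    inequalities: [return_ge] and [budget_ge] show that no strategy exceeds the bounds, [return_le],
    [budget_le_down] and [budget_le_up] that the strategy aimed at [s] succeeds. Success is proved
    by contradiction, without simulating the walk: if it ended at another sink, every subtree off
    the path containing that end would have used up its returns, and climbing from [s] excludes the
    end from one ancestor's subtree after another, up to the whole tree. The arithmetic closes
    because the last entry into the subtree that holds the final position is never returned, and
    this missing return compensates the offset of 1 between two arcs. Simplicity lets crossings be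
    indexed by endpoints and leaves at most two arcs per tree edge, which makes the time linear in
    the number of vertices. *)

Section TreeRoot.

Variables (V : finType) (e : rel V) (r : V).
Hypotheses (e_sym : symmetric e) (e_irr : irreflexive e) (e_tree : is_tree e).

Lemma tree_bridge x y : e x y ->
  ~~ connect [rel a b | e a b && ((a, b) != (x, y)) && ((a, b) != (y, x))] x y.
Proof.
set e' := (X in connect X) => exy; apply/negP=> /connectP[p0 e'p0].
case/shortenP: e'p0 => p e'p p_uniq _ y_last.
have sub_e : subrel e' e by move=> a b /= /andP[/andP[]].
(* The edge closes the path to a cycle; since the path avoids the edge it has an inner vertex, so
   the cycle has more than two vertices. *)
case: e_tree => _ /(_ (x :: p)); apply; last first.
  apply/andP; split=> //=; rewrite rcons_path (sub_path sub_e e'p) /=.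
  by rewrite -y_last e_sym.
case: p e'p y_last {p_uniq} => [_ /= yx|a [|//]].
  by rewrite yx e_irr in exy.
by rewrite /e' /= => /[swap] <-; rewrite eqxx !andbF.
Qed.

(** Any neighbour closer to the root serves as parent. An edge that joins no vertex to its parent
    would be avoided by the parent chains of both its ends, which meet at the root, against
    [tree_bridge]. *)
Lemma tree_parent : exists (par : V -> V) (depth : V -> nat),
  [/\ par r = r,
      forall v, v != r -> e v (par v) /\ depth (par v) < depth v,
      forall v, depth v < #|V| &
      forall x y, e x y -> (y != r) && (par y == x) || (x != r) && (par x == y)].
Proof.
have conn v : exists n, [exists p : n.-tuple V, path e v p && (last v p == r)].
  have [p ep lastp] := connectP (e_tree.1 v r).
  exists (size p); apply/existsP; exists (in_tuple p).
  by rewrite /= ep /= eq_sym -lastp.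
pose depth v := ex_minn (conn v).
have depth_le v p : path e v p -> last v p = r -> depth v <= size p.
  move=> ep lastp; rewrite /depth; case: ex_minnP => m _; apply.
  by apply/existsP; exists (in_tuple p); rewrite /= ep lastp eqxx.
have depth_path v : exists2 p, path e v p /\ last v p = r & size p = depth v.
  rewrite /depth; case: ex_minnP => m /existsP[p /andP[ep /eqP lastp]] _.
  by exists p => //; rewrite size_tuple.
have closer v : v != r -> exists x, e v x && (depth x < depth v).
  move=> v_r; have [[|x p] [/= ep lastp] <-] := depth_path v.
    by rewrite lastp eqxx in v_r.
  by case/andP: ep => evx ep; exists x; rewrite evx ltnS depth_le.
pose par v := if v == r then r else odflt r [pick x | e v x && (depth x < depth v)].
have par_closer v : v != r -> e v (par v) /\ depth (par v) < depth v.
  move=> v_r; rewrite /par (negPf v_r); case: pickP => [x /andP[]//|none].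
  by have [x] := closer v v_r; rewrite none.
exists par, depth; split => //; first by rewrite /par eqxx.
  move=> v; have [p [ep lastp] _] := depth_path v.
  case/shortenP: ep lastp => q eq q_uniq _ lastq.
  have := depth_le _ _ eq lastq; have := max_card (mem (v :: q)).
  by rewrite (card_uniqP q_uniq) /=; lia.
move=> x y exy; apply: contraT; rewrite negb_or => /andP[not_yx not_xy].
have := tree_bridge exy; set e' := (X in connect X); case/negP.
have e'_sym : connect_sym e'.
  apply: sym_connect_sym => a b; rewrite /e' /= e_sym !xpair_eqE -!andbA.
  congr (_ && _); rewrite [LHS]andbC; congr (~~ _ && ~~ _); exact: andbC.
suff to_root v : connect e' v r.
  by apply: connect_trans (to_root x) _; rewrite e'_sym.
have [n le_n] := ubnP (depth v); elim: n v le_n => // n IHn v le_n.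
have [->|v_r] := eqVneq v r; first exact: connect0.
have [evp ltp] := par_closer v v_r.
apply: connect_trans (IHn (par v) _); last by lia.
apply: connect1; rewrite /e' /= evp !xpair_eqE /=.
by apply/andP; split; apply/negP=> /andP[/eqP vE /eqP pE];
  [move: not_xy | move: not_yx]; rewrite -pE -vE v_r eqxx.
Qed.

End TreeRoot.

(** * The ancestor order of a rooted tree *)

Section Subtrees.

Variables (V : finType) (r : V) (par : V -> V) (depth : V -> nat).
Hypotheses (par_root : par r = r)
  (par_depth : forall v, v != r -> depth (par v) < depth v).

(** Read: [v] lies in the subtree of [w]. The root is its own parent, so the orbit of [v] under
    [par] consists of its ancestors. *)
Definition below (w v : V) : bool := fconnect par v w.

Lemma belowE w v : below w v = (v == w) || below w (par v).
Proof. exact: fconnect_eqVf. Qed.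

Lemma below_refl v : below v v.
Proof. exact: connect0. Qed.

Lemma below_trans u v w : below u v -> below v w -> below u w.
Proof. by move=> uv vw; apply: connect_trans vw uv. Qed.

Lemma below_par v : below (par v) v.
Proof. exact: fconnect1. Qed.

Lemma below_depth w v : below w v -> depth w <= depth v.
Proof.
move=> /iter_findex <-; elim: findex => //= n; set x := iter _ _ _.
have [->|/par_depth] := eqVneq x r; rewrite ?par_root //; lia.
Qed.

Lemma below_root v : below r v.
Proof.
have [n] := ubnP (depth v); elim: n v => // n IHn v le_n.
have [->|/par_depth lt] := eqVneq v r; first exact: below_refl.
by rewrite belowE IHn ?orbT //; lia.
Qed.

Lemma root_below w : below w r = (w == r).
Proof.
apply/idP/eqP => [/iter_findex <-|->]; last exact: below_refl.
by elim: findex => //= n ->.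
Qed.

Lemma below_child w v : below w v -> v != w ->
  exists c, [/\ c != r, par c = w & below c v].
Proof.
have [n] := ubnP (depth v); elim: n v => // n IHn v le_n.
rewrite belowE => /orP[->//|wpv] v_w.
have v_r : v != r.
  by apply: contraNneq v_w => v_r; move: wpv; rewrite v_r par_root root_below eq_sym.
have [pvw|pv_w] := eqVneq (par v) w.
  by exists v; split => //; apply: below_refl.
have := par_depth v_r; have [|c [c_r cw cv] _] := IHn (par v) _ wpv pv_w.
  by have := par_depth v_r; lia.
by exists c; split => //; rewrite belowE cv orbT.
Qed.

(** A sibling below another would lie above their common parent or coincide with it, against the
    depth; so the ancestor chain of [v] meets only one of them. *)
Lemma below_child_uniq c c' v : c != r -> c' != r -> par c = par c' ->
  below c v -> below c' v -> c = c'.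
Proof.
have wlog_aux a b : a != r -> b != r -> par a = par b -> below b a -> a = b.
  move=> a_r b_r eq_p; rewrite belowE => /orP[/eqP//|/below_depth].
  by have := par_depth b_r; rewrite eq_p; lia.
move=> c_r c'_r eq_p; have [n] := ubnP (depth v); elim: n v => // n IHn v le_n.
move=> cv c'v; have v_r : v != r.
  by apply: contraNneq c_r => v_r; rewrite -root_below -v_r.
move: (cv) (c'v); rewrite belowE => /orP[/eqP vc c'c|cpv].
  by apply: wlog_aux => //; rewrite -vc.
rewrite belowE => /orP[/eqP vc'|c'pv].
  by apply/esym/wlog_aux => //; rewrite -vc'.
by apply: IHn cpv c'pv; have := par_depth v_r; lia.
Qed.

End Subtrees.

(** * Rotor walks *)

Section Walk.

Variables (V A : finType) (G : rotor_graph V A) (r0 : {ffun V -> A}) (u0 : V).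
Hypotheses (G_simple : simple G) (G_stopping : stopping G)
  (r0_config : forall u, u \notin sinks G -> arc_tail G (r0 u) = u).

Definition walk (t : nat) : {ffun V -> A} * V := iter t (routing_step G) (r0, u0).
Definition pos (t : nat) : V := (walk t).2.

(** Indexed by endpoints rather than arcs, so that both directions of a tree edge can be compared.
    For [u != v] the idle steps on a sink do not count. *)
Fixpoint crossings (t : nat) (u v : V) : nat :=
  if t is s.+1 then crossings s u v + ((pos s == u) && (pos s.+1 == v)) else 0.

Definition rank_arc (x a : A) : nat := index a (orbit (theta G) x).

Lemma pos_sink t : pos t \in sinks G -> pos t.+1 = pos t.
Proof. by rewrite /pos /walk /=; case: (iter _ _ _) => c u /= ->. Qed.

Lemma config_sink t : pos t \in sinks G -> (walk t.+1).1 = (walk t).1.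
Proof. by rewrite /pos /walk /=; case: (iter _ _ _) => c u /= ->. Qed.

Lemma posS t : pos t \notin sinks G -> pos t.+1 = arc_head G ((walk t).1 (pos t)).
Proof. by rewrite /pos /walk /=; case: (iter _ _ _) => c u /= /negPf ->. Qed.

Lemma configS t v : pos t \notin sinks G -> (walk t.+1).1 v =
  if v == pos t then theta G ((walk t).1 v) else (walk t).1 v.
Proof.
by rewrite /pos /walk /=; case: (iter _ _ _) => c u /= /negPf ->; rewrite ffunE; case: eqP => // ->.
Qed.

Lemma orbit_theta a : arc_tail G a \notin sinks G ->
  forall b, (b \in orbit (theta G) a) = (arc_tail G b == arc_tail G a).
Proof. by move=> a_sink b; rewrite theta_orbit // inE. Qed.

(** Injectivity of [theta] is not assumed. The orbit of [theta G a] also fills all arcs with this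
    tail, so it contains [a], and the orbit of [a] is a cycle. *)
Lemma iter_order_theta a : arc_tail G a \notin sinks G ->
  iter (order (theta G) a) (theta G) a = a.
Proof.
move=> a_sink; have ta : arc_tail G (theta G a) = arc_tail G a.
  by apply/eqP; rewrite -orbit_theta // mem_orbit ?in_orbit.
apply/(orbitPcycle 2 4); by rewrite /= inE fconnect_orbit orbit_theta ta.
Qed.

(* [m] is the number of full turns of the rotor at [u] and [q] the number of
   steps of the current turn. *)
Lemma rotor_state t u : u \notin sinks G -> exists m q,
  [/\ q < order (theta G) (r0 u),
      (walk t).1 u = iter q (theta G) (r0 u) &
      forall a, arc_tail G a = u ->
        crossings t u (arc_head G a) = m + (rank_arc (r0 u) a < q)].
Proof.
move=> u_sink; have r0u := r0_config u_sink; elim: t => [|t [m [q [lt_q cfg cr]]]].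
  by exists 0, 0; split => // [|a _]; rewrite ?order_gt0.
have [pos_s|pos_s] := boolP (pos t \in sinks G).
  exists m, q; split => // [|a ta]; rewrite ?config_sink //= cr //.
  by case: eqP => [pt|]; rewrite ?addn0 // -pt pos_s in u_sink *.
have [pt|pt] := eqVneq (pos t) u; last first.
  exists m, q; split => // [|a ta]; first by rewrite configS // eq_sym (negPf pt).
  by rewrite /= (negPf pt) addn0 cr.
have head_eq a : arc_tail G a = u ->
    (pos t.+1 == arc_head G a) = (rank_arc (r0 u) a == q).
  move=> ta; rewrite posS // pt cfg.
  have a_orb : a \in orbit (theta G) (r0 u) by rewrite orbit_theta ?r0u // ta.
  have it_tail : arc_tail G (iter q (theta G) (r0 u)) = u.
    by apply/eqP; rewrite -[eqbRHS]r0u -orbit_theta ?r0u // -fconnect_orbit fconnect_iter.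
  apply/eqP/eqP => [eq_h|<-].
    rewrite -(@G_simple _ a _ eq_h) ?it_tail //; exact: findex_iter.
  by rewrite iter_findex // fconnect_orbit.
have cfgS : (walk t.+1).1 u = iter q.+1 (theta G) (r0 u).
  by rewrite configS // pt eqxx cfg.
have crS a : arc_tail G a = u -> crossings t.+1 u (arc_head G a) =
    m + (rank_arc (r0 u) a < q.+1).
  by move=> ta; rewrite /= cr // head_eq // pt eqxx /=; lia.
have [lt_q1|ge_q1] := ltnP q.+1 (order (theta G) (r0 u)).
  by exists m, q.+1.
have q1 : q.+1 = order (theta G) (r0 u) by lia.
exists m.+1, 0; split => // [|a ta].
  by rewrite cfgS q1 iter_order_theta // r0u.
have : rank_arc (r0 u) a < q.+1.
  by rewrite q1 -size_orbit index_mem orbit_theta ?r0u // ta.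
by rewrite crS // => ->; lia.
Qed.

Lemma config_tail t u : u \notin sinks G -> arc_tail G ((walk t).1 u) = u.
Proof.
move=> u_sink; have r0u := r0_config u_sink.
have [m [q [_ -> _]]] := rotor_state t u_sink.
by apply/eqP; rewrite -[eqbRHS]r0u -orbit_theta ?r0u // -fconnect_orbit fconnect_iter.
Qed.

Lemma rotor_balance t a b : arc_tail G a \notin sinks G ->
  arc_tail G b = arc_tail G a ->
  crossings t (arc_tail G a) (arc_head G a) <=
  crossings t (arc_tail G a) (arc_head G b) +
    (rank_arc (r0 (arc_tail G a)) a < rank_arc (r0 (arc_tail G a)) b).
Proof.
move=> a_sink tb; have [m [q [_ _ cr]]] := rotor_state t a_sink.
by rewrite !cr //; lia.
Qed.

Lemma pos_arc t : pos t \notin sinks G -> exists2 a, arc_tail G a = pos t &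
  arc_head G a = pos t.+1.
Proof.
by move=> pt; exists ((walk t).1 (pos t)); rewrite ?config_tail // posS.
Qed.

Lemma crossings_arc t u v : u != v -> 0 < crossings t u v ->
  u \notin sinks G /\ exists2 a, arc_tail G a = u & arc_head G a = v.
Proof.
move=> u_v; elim: t => //= t IHt.
have [/andP[/eqP pt /eqP pt1] _|_] := boolP ((pos t == u) && (pos t.+1 == v)); last first.
  by rewrite addn0.
have u_sink : u \notin sinks G.
  by apply: contraNN u_v => u_s; rewrite -pt -pt1 pos_sink // pt.
split=> //; have [|a] := @pos_arc t; rewrite ?pt //.
by rewrite pt1; exists a.
Qed.

(** The quantity bounded in the termination proof; it stays 0 at a sink, where the walk idles. *)
Fixpoint departures (t : nat) (v : V) : nat :=
  if t is s.+1 then departures s v + ((pos s == v) && (v \notin sinks G)) else 0.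

(** Between two entries into [v] the particle departs from it, so only the current visit is
    unmatched. *)
Lemma crossings_departures t u v : u != v ->
  crossings t u v <= departures t v + (pos t == v).
Proof.
move=> u_v; elim: t => //= t IHt.
have [pt|pt] := boolP (pos t \in sinks G).
  rewrite pos_sink //.
  have -> : (pos t == u) && (pos t == v) = false.
    by apply: contraNF u_v => /andP[/eqP <- /eqP <-].
  by case: eqVneq IHt => [<-|_] /=; rewrite ?pt; lia.
have pt1 : pos t.+1 != pos t.
  by have [a <- <-] := pos_arc pt; apply: no_loop.
case: (eqVneq (pos t) v) IHt => [ptv|_] /=; last by case: (pos t == u) => /=; lia.
by rewrite -ptv pt (negPf pt1) andbF; lia.
Qed.

(** Each departure uses one of at most [#|A|] arcs, and none of them is used more than once oftener
    than [a]. *)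
Lemma departures_bound t a : arc_tail G a \notin sinks G ->
  departures t (arc_tail G a) <=
  (crossings t (arc_tail G a) (arc_head G a)).+1 * #|A|.
Proof.
move=> a_sink; have [m [q [_ _ cr]]] := rotor_state t a_sink.
set u := arc_tail G a in a_sink cr *.
have -> : departures t u = \sum_(b | arc_tail G b == u) crossings t u (arc_head G b).
  elim: t {m q cr} => [|t IHt] /=; first by rewrite big1.
  rewrite big_split /= -IHt a_sink andbT; congr (_ + _).
  have [ptu|_] := eqVneq; last by rewrite big1.
  have [|b tb hb] := @pos_arc t; first by rewrite ptu.
  rewrite (bigD1 b) ?tb ?ptu //= hb eqxx big1 // => c /andP[/eqP tc c_b].
  rewrite -hb; case: eqP => // hbc.
  by rewrite (@G_simple b c) ?eqxx ?tb ?tc // in c_b.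
apply: (@leq_trans (\sum_(b : A) (crossings t u (arc_head G a)).+1)); last first.
  by rewrite sum_nat_const mulnC.
rewrite [leqRHS](bigID (fun b => arc_tail G b == u)) /=.
apply: leq_trans (leq_addr _ _); apply: leq_sum => b /eqP tb.
by rewrite !cr //; lia.
Qed.

(** Bounds on departures propagate backwards along a directed path to a sink: if the head of an arc
    is left boundedly often, it is entered boundedly often, so the tail is left boundedly often. *)
Lemma walk_stops : exists t, pos t \in sinks G.
Proof.
have bounded v : exists K, forall t, departures t v <= K.
  have [s s_sink /connectP[p]] := G_stopping v.
  elim: p v => [|w p IHp] v /=.
    move=> _ <-; exists 0; elim=> //= t IHt.
    by rewrite s_sink andbF addn0.
  case/andP=> /existsP[a /andP[/eqP ta /eqP ha]] /IHp /[apply] -[K dK].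
  have [v_s|v_s] := boolP (v \in sinks G).
    by exists 0; elim=> //= t IHt; rewrite v_s andbF addn0.
  (* [K] departures from [w], one entry into it not yet left, and one for the rotor offset. *)
  exists (K.+2 * #|A|) => t; rewrite -{1}ta.
  apply: leq_trans (departures_bound _ _) _; rewrite ?ta // leq_mul2r orbC.
  apply/orP; left; rewrite ltnS -[leqRHS]addn1.
  apply: leq_trans (crossings_departures _ _) _.
    by rewrite eq_sym -ta no_loop.
  by rewrite ha leq_add ?dK //; case: eqP.
have [K total] : exists K, forall t, \sum_v departures t v <= K.
  have [Kf dK] : exists Kf : V -> nat, forall t v, departures t v <= Kf v.
    have /fin_all_exists[Kf dK] := bounded.
    by exists Kf => t v; apply: dK.
  by exists (\sum_v Kf v) => t; apply: leq_sum => v _.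
(* Before a sink is reached every step is a departure, so the departures measure time. *)
have count n : (forall t, t < n -> pos t \notin sinks G) -> \sum_v departures n v = n.
  elim: n => [|n IHn] nsink; first by rewrite big1.
  rewrite /= big_split /= IHn => [|t lt_t]; last by apply: nsink; lia.
  rewrite (bigD1 (pos n)) //= eqxx nsink // big1 ?addn0 ?addn1 // => v.
  by rewrite eq_sym => /negPf ->.
have [/existsP[t t_s]|none] := boolP [exists t : 'I_K.+1, pos t \in sinks G].
  by exists t.
have := total K.+1; rewrite count ?ltnn // => t lt_t.
by apply: contraNN none => t_s; apply/existsP; exists (Ordinal lt_t).
Qed.

Lemma sink_reachedP s : sink_reached G r0 u0 = Some s ->
  exists2 t, pos t = s & s \in sinks G.
Proof.
rewrite /sink_reached; case: pickP => // s' /andP[s'_sink /existsP[r' conn]] [<-].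
exists (findex (routing_step G) (r0, u0) (r', s')) => //.
by rewrite /pos /walk iter_findex.
Qed.

Lemma pos_stationary t : pos t \in sinks G -> forall n, pos (t + n) = pos t.
Proof.
move=> t_sink; elim=> [|n IHn]; first by rewrite addn0.
by rewrite addnS pos_sink IHn.
Qed.

(** The pick in [sink_reached] has no freedom: the walk never leaves its first sink. *)
Lemma sink_reached_pos t : pos t \in sinks G -> sink_reached G r0 u0 = Some (pos t).
Proof.
move=> t_sink; case E : (sink_reached G r0 u0) => [s|].
  have [t' <- t'_sink] := sink_reachedP E.
  have [/subnKC <-|/ltnW /subnKC <-] := leqP t' t; first by rewrite pos_stationary.
  by rewrite pos_stationary.
move: E; rewrite /sink_reached; case: pickP => // /(_ (pos t)) + _.
rewrite t_sink => /existsP[]; exists (walk t).1.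
by rewrite /pos -surjective_pairing fconnect_iter.
Qed.

End Walk.

(** * Crossings of the edges of a rooted tree *)

Section RootedWalk.

Variables (V A : finType) (G : rotor_graph V A) (u0 : V).
Variables (par : V -> V) (depth : V -> nat).
Hypotheses (G_simple : simple G) (par_root : par u0 = u0)
  (par_depth : forall v, v != u0 -> depth (par v) < depth v)
  (par_adj : forall x y, adj G x y ->
     (y != u0) && (par y == x) || (x != u0) && (par x == y)).

Definition up_arc (a : A) : bool :=
  (arc_tail G a != u0) && (arc_head G a == par (arc_tail G a)).

Lemma up_arcI a : arc_tail G a != u0 -> arc_head G a = par (arc_tail G a) -> up_arc a.
Proof. by move=> t0 ha; rewrite /up_arc t0 ha eqxx. Qed.

Lemma up_arcP a : up_arc a -> arc_tail G a != u0 /\ arc_head G a = par (arc_tail G a).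
Proof. by case/andP=> ? /eqP. Qed.

Lemma down_arcP a : ~~ up_arc a -> arc_head G a != u0 /\ par (arc_head G a) = arc_tail G a.
Proof.
move=> a_up; have /par_adj/orP[/andP[? /eqP]//|] : adj G (arc_tail G a) (arc_head G a).
  by apply/orP; left; apply/existsP; exists a; rewrite !eqxx.
by rewrite [par _ == _]eq_sym => up; rewrite /up_arc up in a_up.
Qed.

Lemma down_arcN a : arc_head G a != u0 -> par (arc_head G a) = arc_tail G a -> ~~ up_arc a.
Proof.
move=> h0 pa; apply/negP => /up_arcP[t0 ha].
by move: (par_depth h0) (par_depth t0); rewrite pa -ha; lia.
Qed.

Lemma up_arc_uniq a b : arc_tail G a = arc_tail G b -> up_arc a -> up_arc b -> a = b.
Proof.
move=> tab /up_arcP[_ ha] /up_arcP[_ hb].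
by apply: G_simple => //; rewrite ha hb tab.
Qed.

Variable r0 : {ffun V -> A}.
Hypothesis r0_config : forall u, u \notin sinks G -> arc_tail G (r0 u) = u.

Local Notation crossings := (crossings G r0 u0).
Local Notation pos := (pos G r0 u0).
Local Notation below := (below par).

(** By induction on time: a step changes membership in the subtree of [w] only if it runs along the
    edge from [w] to its parent. *)
Lemma edge_balance t w : w != u0 ->
  crossings t (par w) w = crossings t w (par w) + below w (pos t).
Proof.
move=> w0; have lt_w := par_depth w0.
elim: t => [|t IHt]; first by rewrite /= root_below // (negPf w0).
rewrite /= {}IHt; have [pt|pt] := boolP (pos t \in sinks G).
  rewrite pos_sink //.
  by do !case: eqVneq => //= *; subst; lia.
have [a ta ha] := pos_arc G_simple r0_config pt.
have [up|/down_arcP[h0 ph]] := boolP (up_arc a).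
  have [t0 pa] := up_arcP up; rewrite ta ha in t0 pa.
  have lt_t := par_depth t0; rewrite (belowE _ w (pos t)) -pa.
  have [ptw|ptw] := eqVneq (pos t) w.
    have /negPf -> : ~~ below w (pos t.+1).
      apply/negP => /(below_depth par_root par_depth).
      by rewrite pa ptw; lia.
    rewrite pa ptw eqxx /=; have /negPf -> : w != par w.
      by apply: contraTneq lt_w => <-; rewrite ltnn.
    by rewrite addn0.
  have -> : (pos t == par w) && (pos t.+1 == w) = false.
    by apply/negP => /andP[/eqP p1 /eqP p2]; move: lt_t lt_w; rewrite -pa -p1 p2; lia.
  by rewrite /= !addn0.
rewrite ta ha in h0 ph; have lt_t := par_depth h0.
rewrite (belowE _ w (pos t.+1)) ph.
have -> : (pos t == w) && (pos t.+1 == par w) = false.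
  apply/negP => /andP[/eqP p1 /eqP p2].
  by move: lt_t lt_w; rewrite ph p1 p2; lia.
have [ptw|ptw] := eqVneq (pos t.+1) w; last by rewrite andbF; lia.
rewrite -ph ptw eqxx.
have /negPf -> : ~~ below w (par w).
  by apply/negP => /(below_depth par_root par_depth); lia.
by lia.
Qed.

End RootedWalk.

(** * Feasible sinks *)

Section Feasible.

Variables (V A : finType) (G : game V A) (u0 : V).
Variables (par : V -> V) (depth : V -> nat).
Hypotheses (G_simple : simple G) (G_stopping : stopping G) (par_root : par u0 = u0)
  (par_depth : forall v, v != u0 -> depth (par v) < depth v)
  (depth_bound : forall v, depth v < #|V|)
  (par_adj : forall x y, adj G x y ->
     (y != u0) && (par y == x) || (x != u0) && (par x == y)).

Variables (R : pred V) (start : V -> A) (F B : V -> nat).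

Local Notation up_arc := (up_arc G u0 par).
Local Notation below := (below par).
Local Notation tail := (arc_tail G).
Local Notation head := (arc_head G).

Definition precedes (a b : A) : bool :=
  rank_arc G (start (tail a)) a < rank_arc G (start (tail a)) b.

(** What the search guarantees of its queue: no walk leaves it, and the tree path from the root to
    any of its vertices consists of forward arcs. *)
Record reach_spec : Prop := ReachSpec {
  reach_root : R u0;
  reach_step : forall a, tail a \notin sinks G -> R (tail a) -> R (head a);
  reach_par : forall v, R v -> v != u0 ->
    [/\ R (par v), par v \notin sinks G &
        exists2 a, tail a = par v & head a = v] }.

(** At a vertex of V_MAX any outgoing arc will do; it is merely an entry point into the cyclic
    order. *)
Record start_spec : Prop := StartSpec {
  start_tail : forall u, u \notin sinks G -> tail (start u) = u;
  start_rho : forall u, u \notin sinks G -> u \notin maxv G -> start u = rho G u }.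

(* [F w] bounds the number of returns from [w] to its parent. *)
Record return_spec : Prop := ReturnSpec {
  return_sink : forall s, R s -> s \in sinks G -> F s = 0;
  return_dead : forall u, R u -> u \notin sinks G ->
    (forall a, tail a = u -> ~~ up_arc a) -> F u = 0;
  return_le : forall e a, R (tail e) -> tail e \notin sinks G -> up_arc e ->
    tail a = tail e -> ~~ up_arc a ->
    F (tail e) <= F (head a) + ((tail e \in maxv G) || precedes e a);
  return_ge : forall e k, R (tail e) -> tail e \notin sinks G -> up_arc e ->
    k <= #|V| ->
    (forall a, tail a = tail e -> ~~ up_arc a ->
       k <= F (head a) + ((tail e \in maxv G) || precedes e a)) ->
    k <= F (tail e) }.

(* [B x] bounds the number of entries into [x] from its parent. *)
Record budget_spec : Prop := BudgetSpec {
  budget_root : B u0 = 1;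
  budget_pos : forall a, R (tail a) -> tail a \notin sinks G -> ~~ up_arc a ->
    0 < B (head a) -> 0 < B (tail a);
  budget_le_down : forall a b, R (tail a) -> tail a \notin sinks G ->
    tail b = tail a -> a != b -> ~~ up_arc a -> ~~ up_arc b ->
    B (head a) <= F (head b) + ((tail a \in maxv G) || precedes a b);
  budget_le_up : forall a e, R (tail a) -> tail a \notin sinks G ->
    tail e = tail a -> ~~ up_arc a -> up_arc e -> 0 < B (head a) ->
    B (head a) + ((tail a \notin maxv G) && precedes e a) <= B (tail a);
  budget_ge : forall a k, R (tail a) -> tail a \notin sinks G -> ~~ up_arc a ->
    k <= #|V| -> 0 < B (tail a) ->
    (forall b, tail b = tail a -> ~~ up_arc b ->
       k <= F (head b) + [|| a == b, tail a \in maxv G | precedes a b]) ->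
    (forall e, tail e = tail a -> up_arc e ->
       k + ((tail a \notin maxv G) && precedes e a) <= B (tail a)) ->
    k <= B (head a) }.

Hypotheses (R_reach : reach_spec) (startP : start_spec) (F_return : return_spec)
  (B_budget : budget_spec).

Lemma reach_below w v : R v -> below w v -> R w.
Proof.
move=> Rv /iter_findex <-; elim: findex => //= n; set x := iter _ _ _ => Rx.
have [->|x0] := eqVneq x u0; first by rewrite par_root; apply: reach_root R_reach.
by have [] := reach_par R_reach Rx x0.
Qed.

(** * Bounds valid for every strategy *)

Section Config.

Variable sigma : {ffun V -> A}.
Hypothesis sigma_strategy : strategy G sigma.

Local Notation r0 := (join_config G sigma).
Local Notation crossings := (crossings G r0 u0).
Local Notation pos := (pos G r0 u0).

Lemma join_config_tail u : u \notin sinks G -> tail (r0 u) = u.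
Proof.
move=> u_sink; rewrite ffunE; case: ifPn => u_max.
  by have /forall_inP/(_ u u_max) := sigma_strategy; rewrite inE => /eqP.
have /forall_inP/(_ u) := rho_config G; rewrite !inE negb_or u_max u_sink.
by move=> /(_ isT)/eqP.
Qed.

Lemma join_config_rho u : u \notin sinks G -> u \notin maxv G -> r0 u = start u.
Proof. by move=> us um; rewrite ffunE (negPf um) start_rho. Qed.

Lemma rotor_compare t a b : tail a \notin sinks G -> tail b = tail a ->
  crossings t (tail a) (head a) <= crossings t (tail a) (head b) +
    ((tail a \in maxv G) || precedes a b).
Proof.
move=> a_sink tb.
have := rotor_balance u0 G_simple join_config_tail t a_sink tb; rewrite /precedes.
have [a_max|a_max] /= := boolP (tail a \in maxv G); last by rewrite join_config_rho.
by move=> le; apply: leq_trans le _; rewrite leq_add2l leq_b1.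
Qed.

Let edge t w (w0 : w != u0) :=
  edge_balance G_simple par_root par_depth par_adj join_config_tail t w0.

Lemma pos_reach t : R (pos t).
Proof.
elim: t => [|t IHt]; first exact: reach_root R_reach.
have [pt|pt] := boolP (pos t \in sinks G); first by rewrite pos_sink.
have [a ta <-] := pos_arc G_simple join_config_tail pt.
by apply: (reach_step R_reach); rewrite ta.
Qed.

(** Induction from the leaves: [return_ge] asks for one inequality per child, which is the rotor
    comparison of the arc to the parent with the arc to that child. *)
Lemma returns_bound t w : R w -> w != u0 -> minn (crossings t w (par w)) #|V| <= F w.
Proof.
have [n] := ubnP (#|V| - depth w); elim: n t w => // n IHn t w le_n Rw w0.
have [->|cr_gt0] := posnP (crossings t w (par w)); first by rewrite min0n.
have w_pw : w != par w by apply: contraTneq (par_depth w0) => <-; rewrite ltnn.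
have [w_sink [e te he]] := crossings_arc G_simple join_config_tail w_pw cr_gt0.
have up_e : up_arc e by apply: up_arcI; rewrite te.
(* Right after its last return the particle is outside the subtree. *)
have [s out_s ->] : exists2 s, ~~ below w (pos s) &
    crossings t w (par w) = crossings s w (par w).
  elim: t {cr_gt0} => [|t [s s_out IHs]]; first by exists 0; rewrite // root_below // (negPf w0).
  rewrite /=; case: (boolP (_ && _)) => [/andP[/eqP pt /eqP pt1]|_].
    exists t.+1; rewrite /= ?pt ?pt1 ?eqxx //.
    apply/negP => /(below_depth par_root par_depth).
    by rewrite leqNgt par_depth.
  by exists s; rewrite // addn0.
rewrite -te; apply: (return_ge F_return); rewrite ?te ?geq_minr // => a ta a_up.
have [h0 pa] := down_arcP par_adj a_up.
have lt_h := par_depth h0; rewrite pa ta in lt_h.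
have := IHn s (head a) _ _ h0.
have -> : crossings s (head a) (par (head a)) = crossings s (par (head a)) (head a).
  rewrite (edge s h0).
  have /negPf -> : ~~ below (head a) (pos s); last by rewrite addn0.
  by apply: contraNN out_s; apply: below_trans; rewrite -ta -pa below_par.
rewrite pa ta => le_F.
have Fa : minn (crossings s w (head a)) #|V| <= F (head a).
  apply: le_F; first by move: le_n lt_h (depth_bound w); clear; lia.
  by apply: (reach_step R_reach); rewrite ta.
have := @rotor_compare s e a; rewrite te ta he => /(_ w_sink erefl).
by move: Fa; case: (_ || _); clear; lia.
Qed.

(** Induction from the root. Siblings off the path do not hold the final sink, so their entries
    equal their returns; a vertex on the path has one entry more than returns. The inequality for
    the arc to the parent may cost 1, which the cap [#|V| - depth x] absorbs because the depth
    grows. *)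
Lemma entries_bound t x : pos t \in sinks G -> below x (pos t) -> x != u0 ->
  minn (crossings t (par x) x) (#|V| - depth x) <= B x.
Proof.
move=> t_sink; have [n] := ubnP (depth x); elim: n x => // n IHn y le_n ybelow y0.
have lt_y := par_depth y0; set x := par y in lt_y *.
have x_y : x != y by apply: contraTneq lt_y => ->; rewrite ltnn.
have [->|cr_gt0] := posnP (crossings t x y); first by rewrite min0n.
have [x_sink [a ta ha]] := crossings_arc G_simple join_config_tail x_y cr_gt0.
have xbelow : below x (pos t) by apply: below_trans ybelow; apply: below_par.
have down_a : ~~ up_arc a by apply: (down_arcN par_depth); rewrite ha ?ta.
have Rx : R x by apply: reach_below xbelow; apply: pos_reach.
have [x_pos Bx] : 0 < B x /\ (x != u0 -> minn (crossings t (par x) x) (#|V| - depth x) <= B x).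
  have [->|x0] := eqVneq x u0; first by rewrite (budget_root B_budget).
  have Bx : minn (crossings t (par x) x) (#|V| - depth x) <= B x.
    by apply: IHn => //; move: lt_y le_n; clear; lia.
  split=> //; apply: leq_trans Bx; rewrite leq_min (edge t x0) xbelow.
  by move: (depth_bound x); clear; lia.
rewrite -ha; apply: (budget_ge B_budget); rewrite ?ta ?geq_minr //.
- by move: (#|V|) => N; clear; lia.
- move=> b tb down_b; have [h0 pb] := down_arcP par_adj down_b.
  have Fb : minn (crossings t (head b) x) #|V| <= F (head b).
    by rewrite -tb -pb returns_bound //; apply: (reach_step R_reach); rewrite tb.
  have := edge t h0; rewrite pb tb => eq_b.
  (* The last entry into [y] itself is never returned, hence the bound [F y + 1] in this case. *)
  have [ab|a_b] := eqVneq a b; first by move: Fb eq_b; rewrite -ab ha /=; case: below; clear; lia.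
  have := @rotor_compare t a b; rewrite ta tb ha => /(_ x_sink erefl).
  have /negPf out_b : ~~ below (head b) (pos t).
    apply: contraNN a_b => b_below; apply/eqP/(G_simple (etrans ta (esym tb))).
    rewrite ha; apply: (below_child_uniq par_root par_depth) ybelow b_below => //.
    by rewrite pb tb.
  by move: Fb eq_b; rewrite out_b /=; case: (_ || _); clear; lia.
- move=> e te up_e; have [x0 he] := up_arcP up_e; rewrite te in x0 he.
  move: (Bx x0) (edge t x0); rewrite xbelow => {}Bx eq_x.
  move: (@rotor_compare t a e); rewrite ta te ha he => /(_ x_sink erefl).
  rewrite /precedes ta te; move: lt_y Bx eq_x (depth_bound x); clear.
  by case: (x \in maxv G) => /=; lia.
Qed.

Lemma reached_feasible s : sink_reached G r0 u0 = Some s ->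
  [/\ R s, s \in sinks G & 0 < B s].
Proof.
move=> /sink_reachedP[t <- t_sink]; split=> //; first exact: pos_reach.
have [->|s0] := eqVneq (pos t) u0; first by rewrite (budget_root B_budget).
apply: leq_trans (entries_bound t_sink (below_refl _ _) s0).
rewrite (edge t s0) below_refl.
by move: (depth_bound (pos t)); clear; lia.
Qed.

End Config.

(** * Reaching a sink of positive budget *)

Section Target.

Variable s : V.
Hypotheses (Rs : R s) (s_sink : s \in sinks G) (s_budget : 0 < B s).

Definition toward (u : V) (a : A) : bool :=
  [&& tail a == u, head a != u0, par (head a) == u & below (head a) s].

(** On the path, putting the next vertex first ensures that no other arc is used more often than the
    one towards [s]; off the path, putting the parent first makes the returns as numerous as
    possible. [start u] is the default when there is no arc to the parent. *)
Definition target_strategy : {ffun V -> A} := [ffun u =>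
  if [pick a | toward u a] is Some a then a
  else if [pick a | (tail a == u) && up_arc a] is Some a then a else start u].

Lemma target_strategy_valid : strategy G target_strategy.
Proof.
apply/forall_inP => u u_max; rewrite inE ffunE.
case: pickP => [a /and4P[]//|_]; case: pickP => [a /andP[]//|_].
by rewrite (start_tail startP) ?eqxx // (disjointFr (maxv_not_sink G)).
Qed.

Lemma target_strategy_toward a : head a != u0 -> par (head a) = tail a ->
  below (head a) s -> target_strategy (tail a) = a.
Proof.
move=> h0 pa a_s; rewrite ffunE; case: pickP => [b|/(_ a)]; last first.
  by rewrite /toward eqxx h0 pa eqxx a_s.
case/and4P=> /eqP tb h0b /eqP pb b_s; apply: G_simple => //.
by apply: (below_child_uniq par_root par_depth h0b h0 _ b_s a_s); rewrite pb pa.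
Qed.

Lemma target_strategy_up e : ~~ below (tail e) s -> up_arc e ->
  target_strategy (tail e) = e.
Proof.
move=> e_s up_e; rewrite ffunE; case: pickP => [b|_].
  case/and4P=> _ _ /eqP pb b_s; case/negP: e_s; rewrite -pb.
  exact: below_trans (below_par _ _) b_s.
case: pickP => [b /andP[/eqP tb up_b]|/(_ e)]; last by rewrite eqxx up_e.
exact: up_arc_uniq up_b up_e.
Qed.

Local Notation r0 := (join_config G target_strategy).
Local Notation crossings := (crossings G r0 u0).
Local Notation pos := (pos G r0 u0).

Let r0_tail := join_config_tail target_strategy_valid.

Let edge t w (w0 : w != u0) :=
  edge_balance G_simple par_root par_depth par_adj r0_tail t w0.

Lemma rank_arc_start a b : rank_arc G a a < rank_arc G a b = (a != b).
Proof.
by rewrite /rank_arc -!/(findex _ _ _) findex0 lt0n findex_eq0.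
Qed.

Variable t : nat.
Hypotheses (t_sink : pos t \in sinks G) (t_s : pos t != s).

(** A wrong subtree can hold the end of the walk only after all its returns are spent. Climbing from
    the final sink, whose bound is 0, the unreturned last entry into the child [c] pays for the
    rotor offset at its parent. *)
Lemma lost_returns w : below w (pos t) -> w != u0 -> ~~ below w s ->
  F w <= crossings t w (par w).
Proof.
move=> /iter_findex <-; move: (findex _ _ _) => k {w}; elim: k => [|k IHk] /=.
  by rewrite (return_sink F_return) // pos_reach //; apply: target_strategy_valid.
set c := iter k par (pos t) in IHk *; set w := par c => w0 w_s.
have c0 : c != u0 by apply: contraNneq w0 => c0; rewrite /w c0 par_root.
have c_s : ~~ below c s by apply: contraNN w_s; apply/below_trans/below_par.
have {IHk} Fc := IHk c0 c_s; have lt_c := par_depth c0; rewrite -/w in Fc lt_c.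
have c_t : below c (pos t) by apply: fconnect_iter.
have := edge t c0; rewrite -/w c_t => eq_c.
have w_c : w != c by apply: contraTneq lt_c => ->; rewrite ltnn.
have cr_gt0 : 0 < crossings t w c by rewrite eq_c /= addn1.
have [w_sink [a ta ha]] := crossings_arc G_simple r0_tail w_c cr_gt0.
have Rw : R w.
  apply: reach_below (pos_reach target_strategy_valid t) _.
  exact: below_trans (below_par _ _) c_t.
have [/existsP[e /andP[/eqP te up_e]]|noup] :=
  boolP [exists e, (tail e == w) && up_arc e]; last first.
  rewrite (return_dead F_return) // => e te.
  by apply: contraNN noup => up_e; apply/existsP; exists e; rewrite te eqxx.
have [_ he] := up_arcP up_e; rewrite te in he.
have down_a : ~~ up_arc a by apply: (down_arcN par_depth); rewrite ha ?ta.
have Fw := return_le F_return; have := Fw e a; rewrite te ta ha => /(_ Rw w_sink up_e erefl down_a).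
have e_a : e != a by apply: contraNneq down_a => <-.
have := rotor_balance u0 G_simple r0_tail t (a := a) (b := e).
rewrite te ta ha he => /(_ w_sink erefl); rewrite /precedes te.
have [w_max|w_max] := boolP (w \in maxv G) => /=; last first.
  rewrite join_config_rho //; move: Fc eq_c; clear; lia.
have -> : r0 w = e by rewrite ffunE w_max -te target_strategy_up // te.
have := rank_arc_start e a; rewrite e_a.
by move: Fc eq_c; clear; lia.
Qed.

(** Climbing from [s]: if the walk ended below another child [c] of [z], then [lost_returns] and
    [budget_le_down] would force at least [B y] returns from the child [y] on the path, against the
    previous stage. [budget_le_up] carries the strict bound to the next edge. *)
Lemma target_returns k (z := iter k par s) :
  [/\ 0 < B z, ~~ below z (pos t) & z != u0 -> crossings t z (par z) < B z].
Proof.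
rewrite {}/z; elim: k => [|k IHk] /=.
  have no_exit v : s != v -> crossings t s v = 0.
    move=> s_v; apply/eqP; rewrite -leqn0 leqNgt; apply/negP => cr_gt0.
    have [] := crossings_arc G_simple r0_tail s_v cr_gt0.
    by rewrite s_sink.
  split=> //.
    apply/negP => /(below_child par_root par_depth)/(_ t_s)[c [c0 pc c_t]].
    have s_c : s != c.
      by apply: contraTneq (par_depth c0) => eq_c; rewrite pc eq_c ltnn.
    by have := edge t c0; rewrite pc no_exit // c_t; clear; lia.
  move=> s0; rewrite no_exit //.
  by apply: contraTneq (par_depth s0) => <-; rewrite ltnn.
set y := iter k par s in IHk *; set z := par y.
have [y_pos y_t By] := IHk.
have y0 : y != u0.
  by apply: contraNneq y_t => ->; apply: (below_root par_depth).
have {}By : crossings t y z < B y by apply: By.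
have y_s : below y s by apply: fconnect_iter.
have [Rz z_sink [a ta ha]] := reach_par R_reach (reach_below Rs y_s) y0.
rewrite -/z in Rz z_sink ta.
have down_a : ~~ up_arc a by apply: (down_arcN par_depth); rewrite ha ?ta.
have z_pos : 0 < B z.
  by have := budget_pos B_budget; move=> /(_ a); rewrite ta ha; apply.
have eq_y : crossings t z y = crossings t y z.
  by rewrite (edge t y0) (negPf y_t) addn0.
have r0_z : z \in maxv G -> r0 z = a.
  by move=> z_max; rewrite ffunE z_max -ta target_strategy_toward // ha // ta.
have rank_a : z \in maxv G -> rank_arc G (r0 z) a = 0.
  by move=> /r0_z ->; rewrite /rank_arc -/(findex _ _ _) findex0.
split=> //.
  apply/negP => z_t; have t_z : pos t != z by apply: contraNneq z_sink => <-.
  have [c [c0 pc c_t]] := below_child par_root par_depth z_t t_z.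
  have y_c : y != c by apply: contraNneq y_t => ->.
  have c_s : ~~ below c s.
    apply: contraNN y_c => c_s; apply/eqP.
    by apply: (below_child_uniq par_root par_depth y0 c0 _ y_s c_s); rewrite pc.
  have := lost_returns c_t c0 c_s; rewrite pc => Fc.
  have := edge t c0; rewrite pc c_t => eq_c.
  have z_c : z != c by apply: contraTneq (par_depth c0) => zc; rewrite pc zc ltnn.
  have cr_gt0 : 0 < crossings t z c by rewrite eq_c /= addn1.
  have [_ [b tb hb]] := crossings_arc G_simple r0_tail z_c cr_gt0.
  have down_b : ~~ up_arc b by apply: (down_arcN par_depth); rewrite hb ?tb.
  have a_b : a != b by apply: contraNneq y_c => ab; rewrite -ha ab hb.
  have := budget_le_down B_budget; move=> /(_ a b).
  rewrite ta ha hb => /(_ Rz z_sink tb a_b down_a down_b).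
  have := rotor_balance u0 G_simple r0_tail t (a := b) (b := a).
  rewrite tb ta ha hb => /(_ z_sink erefl); rewrite /precedes ta.
  have [z_max|z_max] := boolP (z \in maxv G) => /=.
    by rewrite (rank_a z_max) ltn0; move: Fc eq_c By eq_y; clear; lia.
  by rewrite join_config_rho //; move: Fc eq_c By eq_y; clear; lia.
move=> z0; have [->//|cr_gt0] := posnP (crossings t z (par z)).
have z_pz : z != par z by apply: contraTneq (par_depth z0) => <-; rewrite ltnn.
have [_ [e te he]] := crossings_arc G_simple r0_tail z_pz cr_gt0.
have up_e : up_arc e by apply: up_arcI; rewrite te.
have := budget_le_up B_budget; move=> /(_ a e).
rewrite ta ha => /(_ Rz z_sink te down_a up_e y_pos).
have := rotor_balance u0 G_simple r0_tail t (a := e) (b := a).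
rewrite te ta ha he => /(_ z_sink erefl); rewrite /precedes te.
have [z_max|z_max] := boolP (z \in maxv G) => /=.
  by rewrite (rank_a z_max) ltn0; move: By eq_y; clear; lia.
by rewrite join_config_rho //; move: By eq_y; clear; lia.
Qed.

End Target.

Lemma feasible_reached s : R s -> s \in sinks G -> 0 < B s ->
  exists2 sigma, strategy G sigma &
    sink_reached G (join_config G sigma) u0 = Some s.
Proof.
move=> Rs s_sink s_budget; exists (target_strategy s).
  exact: target_strategy_valid.
have r0_tail := join_config_tail (target_strategy_valid s).
have [t t_sink] := walk_stops u0 G_simple G_stopping r0_tail.
rewrite (sink_reached_pos t_sink); congr Some.
apply/eqP; apply: contraT => t_s.
(* At the root the invariant puts the end of the walk outside the whole tree. *)
have := below_root par_depth s => /iter_findex u0E.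
have := target_returns Rs s_sink s_budget t_sink t_s (findex par s u0).
by rewrite u0E => -[_ /negP[]]; apply: (below_root par_depth).
Qed.

Lemma val_star_feasible :
  val_star G u0 = \max_(s in sinks G | R s && (0 < B s)) sink_val G s.
Proof.
apply/eqP; rewrite eqn_leq; apply/andP; split.
  apply/bigmax_leqP => sigma sigmaP; rewrite /val_strategy.
  case E : sink_reached => [s|//]; have [Rs s_sink Bs] := reached_feasible sigmaP E.
  by apply: (leq_bigmax_cond (F := sink_val G)); rewrite s_sink Rs.
apply/bigmax_leqP => s /andP[s_sink /andP[Rs Bs]].
have [sigma sigmaP E] := feasible_reached Rs s_sink Bs.
have -> : sink_val G s = val_strategy G sigma u0 by rewrite /val_strategy E.
exact: (leq_bigmax_cond (F := val_strategy G ^~ u0)).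
Qed.

End Feasible.

(** * Running minima *)

Section Minimum.

Variables (A : eqType) (N : nat) (p : pred A) (g : A -> nat).

(** A left fold with initial value [N], like the minima that the program updates arc by arc; proofs
    therefore peel off the last element. *)
Definition seq_min (l : seq A) : nat :=
  foldl (fun x a => if p a then minn x (g a) else x) N l.

Lemma seq_min_rcons l a :
  seq_min (rcons l a) = if p a then minn (seq_min l) (g a) else seq_min l.
Proof. by rewrite /seq_min foldl_rcons. Qed.

Lemma leq_seq_min k l :
  (k <= seq_min l) = (k <= N) && all (fun a => p a ==> (k <= g a)) l.
Proof.
elim/last_ind: l => [|l a IHl]; first by rewrite andbT.
rewrite seq_min_rcons all_rcons; case: (p a) => //=.
by rewrite leq_min IHl andbAC andbA.
Qed.

Lemma seq_min_le l a : a \in l -> p a -> seq_min l <= g a.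
Proof.
move=> al pa; have := leqnn (seq_min l).
by rewrite {1}leq_seq_min => /andP[_ /allP/(_ a al)]; rewrite pa.
Qed.

End Minimum.

(** * Explicit recursions for the bounds *)

Section Equations.

Variables (V A : finType) (G : game V A) (u0 : V) (par : V -> V).
Hypothesis G_simple : simple G.
Variables (R : pred V) (start : V -> A).
Hypotheses (R_reach : reach_spec G u0 par R) (startP : start_spec G start).

Local Notation up_arc := (up_arc G u0 par).
Local Notation tail := (arc_tail G).
Local Notation head := (arc_head G).
Local Notation N := #|V|.

Definition arcs_from (u : V) : seq A := orbit (theta G) (start u).

Definition children_min (F : V -> nat) (l : seq A) : nat :=
  seq_min N (predC up_arc) (F \o head) l.

(* A vertex of [V_r] uses the arc to its parent at most [F c + 1] times if the
   arc to its child [c] comes later in the rotor order, and [F c] times if it comes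
   earlier.  At a vertex of [V_MAX] the arc to the parent may be chosen to come
   first; adding [#|V|] then makes the minimum over the earlier children void.  Without an arc to the parent the bound
   is 0. *)
Definition return_value (F : V -> nat) (u : V) : nat :=
  let l := arcs_from u in
  minn (if has up_arc l
        then children_min F (take (find up_arc l) l) + (u \in maxv G) * N else 0)
    (children_min F l).+1.

(** [m] is 1 at a vertex of V_MAX, where the chosen arc can be put first: adding [N] to every term
    then leaves the minimum at [N], the value for no constraint. *)
Definition earlier_min (F : V -> nat) (b m : nat) (l : seq A) : nat :=
  seq_min N predT (fun a => (if up_arc a then b.-1 else F (head a)) + m * N) l.

(* Here the parent counts as a neighbour returning the particle at most [b - 1]
   times.  The child itself is not excluded from the minimum over the children:
   it cannot be entered more than [F c + 1] times anyway. *)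
Definition budget_value (F : V -> nat) (b : nat) (u : V) (a : A) : nat :=
  let l := arcs_from u in
  if b == 0 then 0 else
  minn (earlier_min F b (u \in maxv G) (take (index a l) l))
    (minn (children_min F l) (b.-1 + (if has up_arc l then 0 else N))).+1.

Lemma mem_arcs_from u a : u \notin sinks G -> (a \in arcs_from u) = (tail a == u).
Proof. by move=> us; rewrite /arcs_from orbit_theta (start_tail startP us). Qed.

Lemma precedes_take u a b : u \notin sinks G -> tail a = u -> tail b = u ->
  (a \in take (index b (arcs_from u)) (arcs_from u)) = precedes G start a b.
Proof.
by move=> us ta tb; rewrite in_take ?mem_arcs_from ?ta // /precedes ta.
Qed.

Lemma precedes_total a b : tail a \notin sinks G -> tail b = tail a -> a != b ->
  ~~ precedes G start a b -> precedes G start b a.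
Proof.
move=> as_ tb a_b; rewrite /precedes tb -leqNgt leq_eqVlt => /predU1P[|//].
have a_in : a \in arcs_from (tail a) by rewrite mem_arcs_from.
have b_in : b \in arcs_from (tail a) by rewrite mem_arcs_from // tb.
move=> /esym eq_ab; case/eqP: a_b.
by rewrite -(nth_index a a_in) -(nth_index a b_in); congr nth.
Qed.

Lemma find_up_arc e : tail e \notin sinks G -> up_arc e ->
  find up_arc (arcs_from (tail e)) = index e (arcs_from (tail e)).
Proof.
move=> es up_e; apply: eq_in_find => a; rewrite mem_arcs_from //= => /eqP ta.
apply/idP/eqP => [up_a|->//]; exact: (up_arc_uniq G_simple ta up_a up_e).
Qed.

Lemma has_up_arc e : tail e \notin sinks G -> up_arc e ->
  has up_arc (arcs_from (tail e)).
Proof.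
by move=> es up_e; apply/hasP; exists e; rewrite ?mem_arcs_from.
Qed.

Lemma return_specP F :
  (forall s, R s -> s \in sinks G -> F s = 0) ->
  (forall u, R u -> u \notin sinks G -> F u = return_value F u) ->
  return_spec G u0 par R start F.
Proof.
move=> F_sink F_eq; split=> // [u Ru us noup|e a Re es up_e ta down_a|e k Re es up_e kN Fk].
- rewrite F_eq // /return_value; case: hasP => [[a]|_]; last by rewrite min0n.
  by rewrite mem_arcs_from // => /eqP/noup/negPf ->.
- rewrite F_eq // /return_value has_up_arc // find_up_arc //.
  have a_in : a \in arcs_from (tail e) by rewrite mem_arcs_from // ta.
  (* An offset of 1 is granted by the successor in the second term; without it, [a] belongs to the
     prefix before [e] and the first term applies. *)
  have [late|early] := boolP (_ || _).
    rewrite addn1; apply: leq_trans (geq_minr _ _) _; rewrite ltnS.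
    exact: (@seq_min_le _ _ _ (F \o head)).
  case/norP: early => /negPf e_max e_a; rewrite e_max mul0n !addn0.
  apply: leq_trans (geq_minl _ _) _; apply: (@seq_min_le _ _ _ (F \o head)) => //.
  rewrite precedes_take // precedes_total ?ta //.
  by apply: contraNneq down_a => <-.
rewrite F_eq // /return_value has_up_arc // find_up_arc // leq_min; apply/andP; split.
  case: (boolP (tail e \in maxv G)) Fk => e_max Fk; first by rewrite mul1n (leq_trans kN) ?leq_addl.
  rewrite mul0n addn0 leq_seq_min kN; apply/allP => a a_in; apply/implyP => /= down_a.
  have /eqP ta : tail a == tail e by rewrite -mem_arcs_from // (mem_take a_in).
  have e_a : precedes G start a e by rewrite -(precedes_take es).
  have := Fk a ta down_a; rewrite /=.
  have -> : precedes G start e a = false by move: e_a; rewrite /precedes ta; lia.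
  by rewrite addn0.
case: k kN Fk => // k kN Fk; rewrite ltnS leq_seq_min (ltnW kN); apply/allP => a.
rewrite mem_arcs_from // => /eqP ta; apply/implyP => /= down_a.
by have := Fk a ta down_a; case: (_ || _) => /=; lia.
Qed.

Lemma budget_specP F B : B u0 = 1 ->
  (forall a, R (tail a) -> tail a \notin sinks G -> ~~ up_arc a ->
     B (head a) = budget_value F (B (tail a)) (tail a) a) ->
  budget_spec G u0 par R start F B.
Proof.
move=> B_root B_eq; split=> //.
- by move=> a Ra as_ down_a; rewrite B_eq // /budget_value; by have [] := posnP (B (tail a)).
- move=> a b Ra as_ tb a_b down_a down_b; rewrite B_eq // /budget_value.
  case: eqP => // _; have b_in : b \in arcs_from (tail a) by rewrite mem_arcs_from // tb.
  have [late|early] := boolP (_ || _).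
    rewrite addn1; apply: leq_trans (geq_minr _ _) _; rewrite ltnS.
    apply: leq_trans (geq_minl _ _) _; exact: (@seq_min_le _ _ _ (F \o head)).
  case/norP: early => /negPf a_max nab; rewrite a_max addn0.
  apply: leq_trans (geq_minl _ _) _; rewrite /earlier_min.
  set g := (X in seq_min _ _ X _).
  have -> : F (head b) = g b by rewrite /g (negPf down_b) addn0.
  by apply: seq_min_le => //; rewrite precedes_take // precedes_total.
- move=> a e Ra as_ te down_a up_e; rewrite B_eq // /budget_value.
  case: eqP => // /eqP; rewrite -lt0n => Ba _.
  have hu : has up_arc (arcs_from (tail a)) by rewrite -te has_up_arc ?te.
  rewrite hu addn0; have [early|late] := boolP (_ && _); last first.
    rewrite addn0; apply: leq_trans (geq_minr _ _) _.
    by rewrite -[leqRHS](prednK Ba) ltnS geq_minr.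
  case/andP: early => /negPf a_max ea; rewrite a_max.
  rewrite addn1 -[leqRHS](prednK Ba) ltnS; apply: leq_trans (geq_minl _ _) _.
  rewrite /earlier_min; set g := (X in seq_min _ _ X _).
  have -> : (B (tail a)).-1 = g e by rewrite /g up_e addn0.
  by apply: seq_min_le => //; rewrite precedes_take.
move=> a k Ra as_ down_a kN Ba k_down k_up; rewrite B_eq // /budget_value.
rewrite eqn0Ngt Ba /= leq_min; apply/andP; split.
  rewrite leq_seq_min kN; apply/allP => b b_in; apply/implyP => _.
  have /eqP tb : tail b == tail a by rewrite -mem_arcs_from // (mem_take b_in).
  have ba : precedes G start b a by rewrite -(precedes_take as_).
  have nab : precedes G start a b = false by move: ba; rewrite /precedes tb; lia.
  case: (boolP (tail a \in maxv G)) k_down k_up => a_max k_down k_up.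
    by rewrite mul1n (leq_trans kN) ?leq_addl.
  rewrite addn0; case: ifPn => [up_b|down_b].
    by have := k_up b tb up_b; rewrite ba /=; lia.
  have := k_down b tb down_b; rewrite nab /= orbF.
  have -> : (a == b) = false by apply: contraTF ba => /eqP ->; rewrite /precedes ltnn.
  by rewrite addn0.
case: k kN k_down k_up => // k kN k_down k_up; rewrite ltnS leq_min; apply/andP; split.
  rewrite leq_seq_min (ltnW kN); apply/allP => b.
  rewrite mem_arcs_from // => /eqP tb; apply/implyP => /= down_b.
  by have := k_down b tb down_b; case: (_ || _) => /=; lia.
case: hasP => [[e]|_]; last by rewrite (leq_trans (ltnW kN)) ?leq_addl.
rewrite mem_arcs_from // => /eqP te up_e; have := k_up e te up_e.
by move: Ba; clear; case: (_ && _); lia.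
Qed.

End Equations.

(** * Programs *)

(** Loop-free commands are run by computation: [result] gives the final memory and [duration] a
    memory-independent bound on the time, so only loops need invariants. *)
Fixpoint loop_free (c : cmd) : bool :=
  match c with
  | Seq c1 c2 | If _ c1 c2 => loop_free c1 && loop_free c2
  | While _ _ => false
  | _ => true
  end.

Fixpoint result (c : cmd) (m : memory) : memory :=
  match c with
  | Store x i e => update m x (eval m i) (eval m e)
  | Seq c1 c2 => result c2 (result c1 m)
  | If e c1 c2 => if eval m e != 0 then result c1 m else result c2 m
  | _ => m
  end.

Fixpoint duration (c : cmd) : nat :=
  match c with
  | Store _ i e => (cost i + cost e).+1
  | Seq c1 c2 => duration c1 + duration c2
  | If e c1 c2 => (cost e + maxn (duration c1) (duration c2)).+1
  | _ => 1
  end.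

Fixpoint written (c : cmd) : seq nat :=
  match c with
  | Store x _ _ => [:: x]
  | Seq c1 c2 | If _ c1 c2 => written c1 ++ written c2
  | While _ c => written c
  | Skip => [::]
  end.

Definition agree_off (s : seq nat) (m m' : memory) : Prop :=
  forall x, x \notin s -> m' x =1 m x.

(** A total-correctness triple with time budget [k]. *)
Definition runs (c : cmd) (m : memory) (k : nat) (Q : memory -> Prop) : Prop :=
  exists t m', [/\ exec c m t m', t <= k & Q m'].

Lemma exec_written c m t m' : exec c m t m' -> agree_off (written c) m m'.
Proof.
elim=> {c m t m'} /=.
- by move=> m x.
- by move=> m x i e y; rewrite inE => y_x j; rewrite /update (negPf y_x).
- move=> c1 c2 m1 m2 m3 t1 t2 _ IH1 _ IH2 x; rewrite mem_cat negb_or => /andP[x1 x2] i.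
  by rewrite IH2 // IH1.
- by move=> e c1 c2 m m' t _ _ IH x; rewrite mem_cat negb_or => /andP[x1 _]; apply: IH.
- by move=> e c1 c2 m m' t _ _ IH x; rewrite mem_cat negb_or => /andP[_ x2]; apply: IH.
- by move=> e c m1 m2 m3 t1 t2 _ _ IH1 _ IH2 x xc i; rewrite IH2 // IH1.
- by move=> e c m _ x.
Qed.

Lemma exec_result c m : loop_free c -> exists2 t, exec c m t (result c m) & t <= duration c.
Proof.
elim: c m => [|x i e|c1 IH1 c2 IH2|e c1 IH1 c2 IH2|//] m /=.
- by move=> _; exists 1 => //; apply: ExecSkip.
- by move=> _; exists (cost i + cost e).+1 => //; apply: ExecStore.
- case/andP=> /(IH1 m)[t1 e1 le1] /(IH2 (result c1 m))[t2 e2 le2].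
  by exists (t1 + t2); [apply: ExecSeq e1 e2 | apply: leq_add].
- case/andP=> /(IH1 m)[t1 e1 le1] /(IH2 m)[t2 e2 le2].
  case: eqP => [e0|/eqP e0].
    exists (cost e + t2).+1; first exact: ExecIfFalse.
    by rewrite ltnS leq_add2l leq_max le2 orbT.
  exists (cost e + t1).+1; first exact: ExecIfTrue.
  by rewrite ltnS leq_add2l leq_max le1.
Qed.

Lemma runs_weaken c m k k' (Q Q' : memory -> Prop) : k <= k' ->
  (forall m', agree_off (written c) m m' -> Q m' -> Q' m') ->
  runs c m k Q -> runs c m k' Q'.
Proof.
move=> le_k QQ' [t [m' [ex le_t Qm]]]; exists t, m'; split=> //.
  exact: leq_trans le_k.
by apply: QQ' => //; apply: exec_written ex.
Qed.

Lemma runs_result c m k (Q : memory -> Prop) : loop_free c -> duration c <= k ->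
  Q (result c m) -> runs c m k Q.
Proof.
move=> /(exec_result m)[t ex le_t] le_k Qm; exists t, (result c m); split=> //.
exact: leq_trans le_k.
Qed.

(** The second command also learns which arrays the first leaves alone, so a postcondition need only
    describe what changes. *)
Lemma runs_seq c1 c2 m k1 k2 k (Q1 Q : memory -> Prop) : k1 + k2 <= k ->
  runs c1 m k1 Q1 ->
  (forall m', agree_off (written c1) m m' -> Q1 m' -> runs c2 m' k2 Q) ->
  runs (Seq c1 c2) m k Q.
Proof.
move=> le_k [t1 [m1 [ex1 le1 Q1m]]] /(_ _ (exec_written ex1) Q1m).
case=> t2 [m2 [ex2 le2 Qm]]; exists (t1 + t2), m2; split=> //; first exact: ExecSeq ex1 ex2.
by apply: leq_trans le_k; apply: leq_add.
Qed.

Lemma runs_seq_result c1 c2 m k (Q : memory -> Prop) : loop_free c1 -> duration c1 <= k ->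
  runs c2 (result c1 m) (k - duration c1) Q -> runs (Seq c1 c2) m k Q.
Proof.
move=> /(exec_result m)[t ex le_t] le_k [t2 [m2 [ex2 le2 Qm]]].
exists (t + t2), m2; split=> //; first exact: ExecSeq ex ex2.
by move: le_t le2 le_k; clear; lia.
Qed.

Lemma runs_if e c1 c2 m k (Q : memory -> Prop) : cost e < k ->
  (eval m e != 0 -> runs c1 m (k - (cost e).+1) Q) ->
  (eval m e = 0 -> runs c2 m (k - (cost e).+1) Q) ->
  runs (If e c1 c2) m k Q.
Proof.
move=> le_k r1 r2; have [e0|e0] := eqVneq (eval m e) 0.
  have [t [m' [ex le_t Qm]]] := r2 e0; exists (cost e + t).+1, m'; split=> //.
    exact: ExecIfFalse.
  by move: le_t le_k; clear; lia.
have [t [m' [ex le_t Qm]]] := r1 e0; exists (cost e + t).+1, m'; split=> //.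
  exact: ExecIfTrue.
by move: le_t le_k; clear; lia.
Qed.

(* [I m k]: the loop may start from [m] with [k] units of time left. *)
Lemma runs_while e c (I : memory -> nat -> Prop) (Q : memory -> Prop) :
  (forall m k, I m k -> cost e < k) ->
  (forall m k, I m k -> eval m e = 0 -> Q m) ->
  (forall m k, I m k -> eval m e != 0 ->
     exists2 k1, k1 + (cost e).+1 <= k &
       runs c m k1 (fun m' => I m' (k - (k1 + (cost e).+1)))) ->
  forall m k, I m k -> runs (While e c) m k Q.
Proof.
move=> time stop step m k; have [n] := ubnP k; elim: n m k => // n IHn m k le_n Im.
have [e0|e0] := eqVneq (eval m e) 0.
  exists (cost e).+1, m; split; [exact: ExecWhileFalse | exact: time Im | exact: stop Im e0].
have [k1 le_k [t1 [m1 [ex1 le1 Im1]]]] := step m k Im e0.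
have [|t2 [m2 [ex2 le2 Qm]]] := IHn m1 _ _ Im1; first by move: le_k le_n; clear; lia.
exists (cost e + t1 + t2).+1, m2; split=> //; first exact: ExecWhileTrue ex1 ex2.
by move: le1 le2 le_k; clear; lia.
Qed.

Lemma code_inj (T : finType) : injective (@code T).
Proof. by move=> x y /ord_inj/enum_rank_inj. Qed.

Lemma code_eq (T : finType) (x y : T) : (code x == code y) = (x == y).
Proof. exact/inj_eq/code_inj. Qed.

Lemma code_lt (T : finType) (x : T) : code x < #|T|.
Proof. exact: ltn_ord. Qed.

Lemma table_code (T : finType) (f : T -> nat) x : table f (code x) = f x.
Proof.
rewrite /table (nth_map x) ?nth_enum_rank //.
by rewrite -cardE code_lt.
Qed.

(** * Traversal of a rotor order *)

Local Notation var r := (Read r (Const 0)).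
Local Notation set r e := (Store r (Const 0) e).

(* Arrays 0 to 7 hold the input and the output.  Array 8 holds the first arc of
   each vertex, 9 its parent, 10 the queue, 11 the bound on the returns, 12 its
   minimum over the children, 13 is 0 if there is an arc to the parent and [#|V|]
   otherwise, 15 the budgets.  Cell 0 of arrays 20 to 25 are registers: position
   in the queue, length of the queue, current vertex, current arc, loop flag,
   running minimum. *)
Definition over_arcs (body : cmd) : cmd :=
  Seq (set 23 (Read 8 (var 22))) (Seq (set 24 (Const 1))
    (While (var 24) (Seq body
       (Seq (set 23 (Read 3 (var 23)))
            (set 24 (Bin Defs.Sub (Const 1) (Bin Eq (var 23) (Read 8 (var 22)))))))))%N.

Section OverArcs.

Variables (V A : finType) (G : game V A) (start : V -> A).
Hypothesis startP : start_spec G start.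
Variables (body : cmd) (I : seq A -> memory -> Prop) (m0 : memory) (u : V).
Hypotheses (body_loop_free : loop_free body)
  (body_written : all (fun x => x \notin written body) [:: 3; 8; 22; 23; 24])
  (u_sink : u \notin sinks G)
  (m0_u : m0 22 0 = code u) (m0_start : m0 8 (code u) = code (start u))
  (m0_theta : forall a, arc_tail G a = u -> m0 3 (code a) = code (theta G a)).
Hypotheses
  (I_init : I [::] m0)
  (I_ext : forall l m m', agree_off [:: 23; 24] m m' -> I l m -> I l m')
  (I_step : forall l1 a l2 m, arcs_from G start u = l1 ++ a :: l2 ->
     agree_off (23 :: 24 :: written body) m0 m -> m 23 0 = code a ->
     I l1 m -> I (rcons l1 a) (result body m)).

Let l := arcs_from G start u.

(** Correctness of the exit test: the orbit has no repetition, so the first arc recurs exactly after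
    a full turn. *)
Lemma next_arc l1 a l2 : l = l1 ++ a :: l2 ->
  theta G a = head (start u) l2 /\ (theta G a == start u) = (l2 == [::]).
Proof.
have st := start_tail startP u_sink; have st_s : arc_tail G (start u) \notin sinks G by rewrite st.
move=> lE; have sz : size l = order (theta G) (start u) by apply: size_orbit.
have nth_l i : i < size l -> nth (start u) l i = iter i (theta G) (start u).
  by rewrite sz => lt_i; apply: (nth_traject _ lt_i).
have aE : a = iter (size l1) (theta G) (start u).
  rewrite -nth_l lE ?nth_cat ?ltnn ?subnn // size_cat /=; lia.
have l_uniq : uniq l by apply: orbit_uniq.
case: l2 lE => [|b l2] lE /=.
  have -> : theta G a = start u; last by rewrite eqxx.
  rewrite aE -iterS -[RHS](iter_order_theta st_s) -sz lE size_cat /=.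
  by rewrite addn1.
have szb : (size l1).+1 < size l by rewrite lE size_cat /=; lia.
have bE : b = theta G a.
  rewrite aE -iterS -nth_l // lE nth_cat ltnNge leqnSn /= subSnn //.
split=> //; rewrite -bE; apply/negP => /eqP b_st.
have := nth_uniq (start u) szb (ltn_trans (ltn0Sn _) szb) l_uniq.
rewrite nth_l // iterS -aE -bE b_st nth_l //= ?eqxx //.
exact: ltn_trans szb.
Qed.

(** The loop ends when the first arc recurs, so the body precedes the test. One extra round in the
    bound pays for the setup and for the final test. *)
Lemma runs_over_arcs k : (duration body + 20) * (size l).+1 <= k ->
  runs (over_arcs body) m0 k (I l).
Proof.
move=> le_k; rewrite /over_arcs.
have [l2 lE] : exists l2, l = start u :: l2.
  have := orderSpred (theta G) (start u); rewrite /l /arcs_from /orbit => <-.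
  by eexists.
apply: runs_seq_result => //; first by move: le_k; rewrite /= lE /=; lia.
apply: runs_seq_result => //; first by move: le_k; rewrite /= lE /=; lia.
set D := duration body + 20 in le_k *.
(* Either the flag is down and the turn complete, or [a] is the current arc and [l3] follows it. The
   2 pays for reading the flag at the end. *)
pose J m k := [/\ agree_off (23 :: 24 :: written body) m0 m & 
  (m 24 0 = 0 /\ I l m /\ 2 < k) \/
  exists l1 a l3, [/\ l = l1 ++ a :: l3, m 24 0 = 1, m 23 0 = code a, I l1 m &
    D * (size l3).+1 + 2 < k]].
have body_w x : x \in [:: 3; 8; 22; 23; 24] -> x \notin written body.
  by move=> xin; apply: (allP body_written).
apply: (@runs_while _ _ J); rewrite /J.
- move=> m {le_k} k [_ []]; first by case=> _ [].
  by case=> l1 [a [l3 [_ _ _ _]]] /=; lia.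
- move=> m {le_k} k [_ []]; first by case=> _ [].
  by case=> l1 [a [l3 [_ /= -> _ _]]].
- move=> m {le_k} k [fr []]; first by case=> /= ->.
  case=> l1 [a [l3 [lEa m24 m23 Il1 le_k _]]].
  exists (duration body + 15); first by move: le_k; rewrite /D /=; lia.
  apply: runs_result; rewrite /= ?body_loop_free //.
  set m1 := result body m.
  have [t ex _] := exec_result m body_loop_free.
  have fr1 := exec_written ex; rewrite -/m1 in fr1.
  have same x : x \in [:: 3; 8; 22] -> m1 x =1 m0 x.
    move=> xin i; rewrite fr1; last by apply: body_w; move: xin; rewrite !inE; lia.
    apply: fr; rewrite !inE !negb_or body_w ?andbT.
      by move: xin; rewrite !inE; lia.
    by move: xin; rewrite !inE; lia.
  have a_in : a \in l by rewrite lEa mem_cat mem_head orbT.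
  have ta : arc_tail G a = u by apply/eqP; rewrite -(mem_arcs_from startP).
  have m1_a : m1 23 0 = code a by rewrite fr1 ?m23 ?body_w.
  rewrite /update /= m1_a !same // m0_u m0_start m0_theta // code_eq.
  have [next last] := next_arc lEa; rewrite last.
  set m2 := (fun y j : nat => _).
  have fr2 : agree_off [:: 23; 24] m1 m2.
    move=> x; rewrite !inE negb_or /m2 => /andP[/negPf x23 /negPf x24] i.
    by rewrite x23 x24.
  have Im2 : I (rcons l1 a) m2 by apply: I_ext fr2 (I_step lEa fr m23 Il1).
  split.
    move=> x x_off i; rewrite fr2 ?fr1 ?fr //.
      by apply: contraNN x_off => xin; rewrite !inE xin !orbT.
    by apply: contraNN x_off; rewrite !inE => /orP[] ->; rewrite ?orbT.
  case: l3 lEa le_k next {last} @m2 fr2 Im2 => [|b l3] lEa le_k next m2 fr2 Im2.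
    left; split=> //; split; first by rewrite lEa cats1.
    by move: le_k; rewrite /D /=; clear; lia.
  right; exists (rcons l1 a), b, l3; split=> //.
  - by rewrite lEa cat_rcons.
  - by rewrite next.
  - by move: le_k; rewrite /D /=; move: (size l3) => n; clear; nia.
split.
  move=> x x_off i; rewrite /= /update.
  by move: x_off; rewrite !inE !negb_or => /and3P[/negPf -> /negPf -> _].
right; exists [::], (start u), l2; split=> //.
- by rewrite /= /update /= m0_u m0_start.
- apply: I_ext I_init => x; rewrite !inE negb_or => /andP[/negPf x23 /negPf x24] i.
  by rewrite /= /update x23 x24.
- by move: le_k; rewrite lE /= /D; move: (size l2) => n; clear; nia.
Qed.

End OverArcs.

Lemma runs_seq_store x i e c m k (Q : memory -> Prop) : cost i + cost e < k ->
  (forall m', (forall y j, m' y j =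
       if (y == x) && (j == eval m i) then eval m e else m y j) ->
     runs c m' (k - (cost i + cost e).+1) Q) ->
  runs (Seq (Store x i e) c) m k Q.
Proof. by move=> lt_k r; apply: runs_seq_result => //; apply: r. Qed.

Lemma agree_off_trans s m1 m2 m3 :
  agree_off s m1 m2 -> agree_off s m2 m3 -> agree_off s m1 m3.
Proof. by move=> a12 a23 x xs i; rewrite a23 // a12. Qed.

Lemma agree_off_sub (s s' : seq nat) m1 m2 : {subset s <= s'} ->
  agree_off s m1 m2 -> agree_off s' m1 m2.
Proof. by move=> ss a x xs i; apply: a; apply: contraNN xs => /ss. Qed.

Lemma agree_off_update m x i v : agree_off [:: x] m (update m x i v).
Proof. by move=> y; rewrite inE /update => /negPf -> j. Qed.

(** * The algorithm *)

Section Algorithm.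

Variables (V A : finType) (G : game V A) (u0 : V).
Hypotheses (G_simple : simple G) (G_stopping : stopping G).

Local Notation tail := (arc_tail G).
Local Notation head := (arc_head G).

Definition has_input (m : memory) : Prop := forall x, x < 7 -> m x =1 encode G u0 x.

Lemma has_input_agree s m m' : all (leq 7) s -> agree_off s m m' ->
  has_input m -> has_input m'.
Proof.
move=> /allP s7 a_m in_m x x7 i; rewrite a_m ?in_m //.
by apply/negP => /s7; rewrite leqNgt x7.
Qed.

Section Input.

Variable m : memory.
Hypothesis m_input : has_input m.

Lemma input_vertices : m 0 0 = #|V|. Proof. by rewrite m_input. Qed.
Lemma input_arcs : m 0 1 = #|A|. Proof. by rewrite m_input. Qed.
Lemma input_start : m 0 2 = code u0. Proof. by rewrite m_input. Qed.
Lemma input_tail a : m 1 (code a) = code (tail a).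
Proof. by rewrite m_input // /encode table_code. Qed.
Lemma input_head a : m 2 (code a) = code (head a).
Proof. by rewrite m_input // /encode table_code. Qed.
Lemma input_theta a : tail a \notin sinks G -> m 3 (code a) = code (theta G a).
Proof. by move=> /negPf as_; rewrite m_input // /encode table_code as_. Qed.
Lemma input_sink u : (m 4 (code u) == 2) = (u \in sinks G).
Proof.
by rewrite m_input // /encode table_code /vertex_kind; case: ifP => //; case: ifP.
Qed.
Lemma input_max u : u \notin sinks G -> m 4 (code u) = (u \in maxv G).
Proof.
by move=> /negPf us; rewrite m_input // /encode table_code /vertex_kind us; case: ifP.
Qed.
Lemma input_val s : s \in sinks G -> m 5 (code s) = sink_val G s.
Proof. by move=> ss; rewrite m_input // /encode table_code ss. Qed.
Lemma input_rho u : m 6 (code u) = if u \in randv G then code (rho G u) else 0.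
Proof. by rewrite m_input // /encode table_code. Qed.

End Input.

(** * Entry points into the rotor orders *)

(** No test is made: the kind multiplies the arc number, so kind 0 stores the given rotor and kind 1
    the current arc, the last one scanned prevailing. The entry of a sink is meaningless. *)
Definition first_arcs : cmd :=
  While (Bin Leq (Bin Add (var 20) (Const 1)) (Read 0 (Const 1)))
    (Seq (Store 8 (Read 1 (var 20))
            (Bin Add (Bin Mul (Read 4 (Read 1 (var 20))) (var 20))
                     (Read 6 (Read 1 (var 20)))))
         (set 20 (Bin Add (var 20) (Const 1)))).

Lemma nonsink_arc u : u \notin sinks G -> exists a, tail a = u.
Proof.
move=> us; have [s ss /connectP[[|v p] /=]] := G_stopping u.
  by move=> _ su; rewrite -su ss in us.
by case/andP=> /existsP[a /andP[/eqP ta _]] _ _; exists a.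
Qed.

Lemma rho_tail u : u \notin sinks G -> u \notin maxv G -> tail (rho G u) = u.
Proof.
move=> us um; have /forall_inP/(_ u) := rho_config G.
by rewrite !inE negb_or us um => /(_ isT)/eqP.
Qed.

Lemma runs_first_arcs m0 k : has_input m0 -> m0 20 0 = 0 -> 40 * #|A|.+1 <= k ->
  runs first_arcs m0 k (fun m => exists2 start, start_spec G start &
    forall u, u \notin sinks G -> m 8 (code u) = code (start u)).
Proof.
have [n nE] : exists n, n = #|A| by exists #|A|.
rewrite -nE => m0_input m0_i le_k.
pose J m k := exists i, [/\ m 20 0 = i, agree_off [:: 8; 20] m0 m,
  40 * (n - i).+1 <= k &
  forall a, code a < i -> tail a \notin sinks G -> exists2 b,
    tail b = tail a /\ (tail a \notin maxv G -> b = rho G (tail a)) &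
    m 8 (code (tail a)) = code b].
apply: (@runs_while _ _ J); rewrite /J; last by exists 0; split=> //; rewrite subn0.
- by move=> m {le_k} k [i [_ _]] /=; lia.
- move=> m {le_k} k [i [mi fr _ Ji]] /=; rewrite mi => /eqP.
  have m_input : has_input m by apply: has_input_agree fr m0_input.
  rewrite input_arcs // -nE eqb0 addn1 -leqNgt => le_i.
  have {}Ji u : u \notin sinks G -> exists2 b,
      tail b = u /\ (u \notin maxv G -> b = rho G u) & m 8 (code u) = code b.
    move=> us; have [a ta] := nonsink_arc us.
    by have := Ji a; rewrite ta; apply=> //; apply: leq_trans le_i; rewrite nE code_lt.
  (* Read back from the final memory; the default never occurs at a non-sink. *)
  pose start u := odflt (rho G u) [pick b | code b == m 8 (code u)].
  have startE u : u \notin sinks G -> exists2 b,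
      tail b = u /\ (u \notin maxv G -> b = rho G u) & start u = b.
    move=> /Ji[b tb mb]; exists b => //; rewrite /start mb.
    by case: pickP => [c|/(_ b)]; rewrite code_eq ?eqxx // => /eqP.
  exists start.
    by split=> [u us|u us um]; have [b [tb rb] ->] := startE u us; [|apply: rb].
  move=> u us; have [b tb mb] := Ji u us; rewrite mb /start mb.
  by case: pickP => [c|/(_ b)]; rewrite code_eq ?eqxx // => /eqP ->.
move=> m {le_k} k [i [mi fr le_k Ji]] /=; rewrite mi => lt_i.
have m_input : has_input m by apply: has_input_agree fr m0_input.
rewrite input_arcs // -nE eqb0 negbK addn1 in lt_i.
exists 30; first by move: le_k lt_i; clear; lia.
rewrite nE in lt_i.
have [x xi] : exists x : A, code x = i.
  by exists (enum_val (Ordinal lt_i)); rewrite /code enum_valK.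
rewrite -nE in lt_i.
apply: runs_seq_store => //= m1 m1E; apply: runs_result => //=.
exists i.+1; rewrite /update /=; split.
- by rewrite m1E /= mi addn1.
- move=> y; rewrite !inE negb_or => /andP[/negPf y8 /negPf y20] j.
  by rewrite y20 /= m1E y8 /= fr // !inE y8 y20.
- by move: le_k lt_i; clear; lia.
move=> a; rewrite m1E /= mi -xi input_tail // input_rho // code_eq ltnS => le_a as_.
case: eqP => [ta|ta]; last first.
  apply: Ji => //; rewrite -xi ltn_neqAle le_a andbT.
  by apply/eqP => /code_inj ax; rewrite ax in ta.
rewrite -ta input_max // /randv !inE.
have [a_max|a_max] := boolP (tail a \in maxv G).
  by exists x; rewrite ?ta //= mul1n addn0.
rewrite (negPf as_) /=; exists (rho G (tail a)) => //.
by split=> //; apply: rho_tail.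
Qed.

(** * Arc count and breadth-first search *)

Variables (par : V -> V) (depth : V -> nat).
Hypotheses (par_root : par u0 = u0)
  (par_depth : forall v, v != u0 -> depth (par v) < depth v)
  (par_adj : forall x y, adj G x y ->
     (y != u0) && (par y == x) || (x != u0) && (par x == y)).

Local Notation up_arc := (up_arc G u0 par).

(** An arc is determined by its direction and the lower end of its tree edge. *)
Lemma leq_arcs_vertices : #|A| <= 2 * #|V|.
Proof.
pose f a := (up_arc a, if up_arc a then tail a else head a).
have f_inj : injective f.
  move=> a b; rewrite /f; have [up_a|up_a] := boolP (up_arc a);
    have [up_b|up_b] := boolP (up_arc b) => // -[tab].
    exact: (up_arc_uniq G_simple tab up_a up_b).
  have [_ pa] := down_arcP par_adj up_a; have [_ pb] := down_arcP par_adj up_b.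
  by apply: (G_simple _ tab); rewrite -pa -pb tab.
by have := leq_card f f_inj; rewrite card_prod card_bool.
Qed.

Variables (start : V -> A).
Hypothesis startP : start_spec G start.

Local Notation arcs_from := (arcs_from G start).

(* Up to a constant factor, the time spent on [u] in each phase. *)
Definition weight (u : V) : nat :=
  if u \in sinks G then 1 else (size (arcs_from u)).+1.

Lemma sum_weight : \sum_u weight u <= 3 * #|V|.
Proof.
apply: (@leq_trans (\sum_u (1 + #|[set a | tail a == u]|))).
  apply: leq_sum => u _; rewrite /weight; case: ifPn => us.
    exact: leq_addr.
  rewrite add1n ltnS -(card_uniqP (orbit_uniq _ _)) subset_leq_card //.
  by apply/subsetP => a; rewrite inE [a \in orbit _ _]mem_arcs_from.
rewrite big_split /= sum1_card [3 * _]mulSn leq_add2l.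
apply: leq_trans leq_arcs_vertices.
rewrite -sum1_card (partition_big tail xpredT) //=; apply: leq_sum => u _.
by rewrite -sum1_card; apply: eq_leq; apply: eq_bigl => a; rewrite inE.
Qed.

(* The first [i] vertices of the queue [q] are explored, and of the arcs of the
   next one those in [l] are. *)
Record search_inv (q : seq V) (i : nat) (l : seq A) : Prop := SearchInv {
  search_uniq : uniq q;
  search_root : 0 < size q /\ nth u0 q 0 = u0;
  search_par : forall v, v \in q -> v != u0 ->
    [/\ par v \notin sinks G,
        exists2 a, tail a = par v & head a = v,
        index (par v) q < index v q &
        par v \in take i q \/
          par v = nth u0 q i /\ exists2 a, a \in l & head a = v];
  search_closed : forall a, tail a \notin sinks G -> ~~ up_arc a ->
    tail a \in take i q \/ a \in l -> head a \in q }.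

Lemma search_step_up q i l a : up_arc a ->
  search_inv q i l -> search_inv q i (rcons l a).
Proof.
move=> up_a [q_uniq q_root q_par q_closed]; split=> //.
  move=> v vq v0; have [ps arcv lt_v [pq|[pv [b bl hb]]]] := q_par v vq v0; split=> //.
    by left.
  by right; split=> //; exists b; rewrite // mem_rcons inE bl orbT.
move=> b bs down_b; rewrite mem_rcons inE => -[bq|/predU1P[ba|bl]].
- by apply: q_closed => //; left.
- by rewrite ba up_a in down_b.
- by apply: q_closed => //; right.
Qed.

(** The search needs no visited marks: a vertex other than the root is queued only along the arc
    from its parent, so a second discovery would scan the same arc twice. *)
Lemma search_step_down q i l a l2 (u := nth u0 q i) :
  i < size q -> u \notin sinks G -> arcs_from u = l ++ a :: l2 -> ~~ up_arc a ->
  search_inv q i l -> search_inv (rcons q (head a)) i (rcons l a).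
Proof.
move=> lt_i us lE down_a [q_uniq [q_gt0 q0] q_par q_closed].
have uq : u \in q by apply: mem_nth.
have a_in : a \in arcs_from u by rewrite lE mem_cat mem_head orbT.
have ta : tail a = u by apply/eqP; rewrite -(mem_arcs_from startP).
have [h0 pa] := down_arcP par_adj down_a; rewrite ta in pa.
have u_take : u \notin take i q by rewrite in_take // index_uniq // ltnn.
have l_uniq : uniq (arcs_from u) by apply: orbit_uniq.
have new : head a \notin q.
  apply/negP => hq; have [_ _ _] := q_par _ hq h0; rewrite pa.
  case=> [uin|[_ [b bl hb]]]; first by rewrite uin in u_take.
  have b_in : b \in arcs_from u by rewrite lE mem_cat bl.
  have tb : tail b = u by apply/eqP; rewrite -(mem_arcs_from startP).
  have ba : b = a by apply: G_simple; rewrite ?ta.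
  move: l_uniq; rewrite lE cat_uniq => /and3P[_ /hasPn/(_ a)].
  by rewrite mem_head -ba bl => /(_ isT).
have take_q : take i (rcons q (head a)) = take i q.
  by rewrite -cats1 takel_cat // ltnW.
have nth_q j : j < size q -> nth u0 (rcons q (head a)) j = nth u0 q j.
  by move=> lt_j; rewrite nth_rcons lt_j.
have index_q v : v \in q -> index v (rcons q (head a)) = index v q.
  by move=> vq; rewrite -cats1 index_cat vq.
split.
- by rewrite rcons_uniq new.
- by rewrite size_rcons nth_q.
- move=> v; rewrite mem_rcons inE take_q nth_q // => /predU1P[->|vq] v0.
    split; rewrite ?pa //; first by exists a.
      by rewrite index_q // -cats1 index_cat (negPf new) /= eqxx addn0 index_mem.
    by right; split=> //; exists a; rewrite // mem_rcons mem_head.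
  have [ps arcv lt_v alt] := q_par v vq v0; split=> //.
    by rewrite !index_q // -index_mem; apply: ltn_trans lt_v _; rewrite index_mem.
  case: alt => [pq|[pv [b bl hb]]]; first by left.
  by right; split=> //; exists b; rewrite // mem_rcons inE bl orbT.
move=> b bs down_b; rewrite take_q !mem_rcons !inE => -[bq|/predU1P[->|bl]].
- by rewrite q_closed ?orbT //; left.
- by rewrite eqxx.
- by rewrite q_closed ?orbT //; right.
Qed.

Lemma search_next q i (u := nth u0 q i) : i < size q ->
  search_inv q i (if u \in sinks G then [::] else arcs_from u) ->
  search_inv q i.+1 [::].
Proof.
move=> lt_i; set l := if _ then _ else _ => -[q_uniq q_root q_par q_closed].
have takeE v : (v \in take i.+1 q) = (v == u) || (v \in take i q).
  by rewrite (take_nth u0) // mem_rcons inE.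
split=> //.
  move=> v vq v0; have [ps arcv lt_v alt] := q_par v vq v0; split=> //; left.
  by rewrite takeE; case: alt => [->|[-> _]]; rewrite ?orbT ?eqxx.
move=> a as_ down_a [|//]; rewrite takeE => /predU1P[ta|ain]; apply: q_closed => //.
  right; rewrite /l; have := as_; rewrite ta => /negPf us.
  by rewrite us (mem_arcs_from startP) ?us // ta.
by left.
Qed.

Lemma search_reach q : search_inv q (size q) [::] -> reach_spec G u0 par (mem q).
Proof.
move=> [q_uniq [q_gt0 q0] q_par q_closed]; rewrite take_size in q_par q_closed.
have par_q v : v \in q -> v != u0 -> par v \in q.
  by move=> vq v0; have [_ _ _ [//|[_ [//]]]] := q_par v vq v0.
split=> [|a as_ /= tq|v /= vq v0].
- by rewrite /= -{1}q0 mem_nth.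
- have [/up_arcP[t0 ->]|down_a] := boolP (up_arc a); first exact: par_q.
  by apply: q_closed => //; left.
- by have [ps arcv _ _] := q_par v vq v0; split=> //; apply: par_q.
Qed.

(** The parent entry of the root is [#|V|], the code of no vertex, so that comparing a head with the
    parent entry never succeeds there. *)
Definition queue_mem (m : memory) (q : seq V) : Prop :=
  [/\ m 21 0 = size q,
      forall j, j < size q -> m 10 j = code (nth u0 q j) &
      forall v, v \in q -> m 9 (code v) = if v == u0 then #|V| else code (par v)].

Lemma queue_mem_agree (s : seq nat) m m' q : all (fun x => x \notin s) [:: 9; 10; 21] ->
  agree_off s m m' -> queue_mem m q -> queue_mem m' q.
Proof.
case/and4P=> s9 s10 s21 _ a_m [m21 m10 m9].
by split=> [|j lt_j|v vq]; rewrite a_m //; [apply: m10 | apply: m9].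
Qed.

Lemma parent_test m q a : has_input m -> queue_mem m q -> tail a \in q ->
  (m 2 (code a) == m 9 (code (tail a))) = up_arc a.
Proof.
move=> m_input [_ _ m9] tq; rewrite m9 // input_head // /up_arc.
have [_|_] /= := eqVneq (tail a) u0; last by rewrite code_eq.
by apply: ltn_eqF; apply: code_lt.
Qed.

Definition visit_arc : cmd :=
  If (Bin Eq (Read 2 (var 23)) (Read 9 (var 22))) Skip
    (Seq (Store 9 (Read 2 (var 23)) (var 22))
    (Seq (Store 10 (var 21) (Read 2 (var 23)))
         (set 21 (Bin Add (var 21) (Const 1))))).

Definition search : cmd :=
  Seq (set 20 (Const 0))
  (Seq (Store 10 (Const 0) (Read 0 (Const 2)))
  (Seq (Store 9 (Read 0 (Const 2)) (Read 0 (Const 0)))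
  (Seq (set 21 (Const 1))
       (While (Bin Leq (Bin Add (var 20) (Const 1)) (var 21))
         (Seq (set 22 (Read 10 (var 20)))
         (Seq (If (Bin Eq (Read 4 (var 22)) (Const 2)) Skip (over_arcs visit_arc))
              (set 20 (Bin Add (var 20) (Const 1))))))))).

Lemma runs_visit_arcs m q i (u := nth u0 q i) k :
  has_input m -> i < size q -> u \notin sinks G -> m 22 0 = code u ->
  m 8 (code u) = code (start u) ->
  search_inv q i [::] -> queue_mem m q ->
  (duration visit_arc + 20) * (size (arcs_from u)).+1 <= k ->
  runs (over_arcs visit_arc) m k (fun m' => exists q', let q1 := q ++ q' in
    search_inv q1 i (arcs_from u) /\ queue_mem m' q1).
Proof.
move=> m_input lt_i us m22 m8 inv_q mem_q le_k.
pose I l m' := exists q', let q1 := q ++ q' in search_inv q1 i l /\ queue_mem m' q1.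
apply: (runs_over_arcs startP (I := I)) => //.
- by move=> a ta; rewrite input_theta // ta.
- by exists [::]; rewrite cats0.
- move=> l m1 m2 a_m [q' [inv1 mem1]]; exists q'; split=> //.
  exact: queue_mem_agree a_m mem1.
move=> l1 a l2 m1 lE a_m m1_a [q' [inv1 mem1]].
have m1_input : has_input m1 by apply: has_input_agree a_m m_input.
have m1_u : m1 22 0 = code u by rewrite a_m.
have lt_i1 : i < size (q ++ q') by rewrite size_cat ltn_addr.
have uE : nth u0 (q ++ q') i = u by rewrite nth_cat lt_i.
have ta : tail a = u.
  by apply/eqP; rewrite -(mem_arcs_from startP) // lE mem_cat mem_head orbT.
have uq : u \in q ++ q' by rewrite -uE mem_nth.
have := @parent_test m1 (q ++ q') a m1_input mem1; rewrite ta => /(_ uq) test.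
rewrite /I /= m1_a m1_u test; have [up_a|down_a] := boolP (up_arc a).
  by exists q'; split=> //; apply: search_step_up.
exists (rcons q' (head a)); rewrite -rcons_cat.
have inv2 := search_step_down lt_i1; rewrite uE in inv2.
have {}inv2 := inv2 l1 a l2 us lE down_a inv1.
have [h0 pa] := down_arcP par_adj down_a.
have [m21 m10 m9] := mem1; have := search_uniq inv2.
rewrite rcons_uniq => /andP[new _]; split=> //.
rewrite /update /= m1_a m21 input_head //; split=> [|j|v] /=.
- by rewrite size_rcons addn1.
- rewrite size_rcons ltnS nth_rcons => le_j.
  case: (ltngtP j (size (q ++ q'))) le_j => // lt_j _.
  exact: m10.
- rewrite mem_rcons inE code_eq; have [->|v_h] /= := eqVneq v (head a).
    by rewrite (negPf h0) pa ta.
  exact: m9.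
Qed.

Lemma runs_search m0 k : has_input m0 ->
  (forall u, u \notin sinks G -> m0 8 (code u) = code (start u)) ->
  (duration visit_arc + 60) * (\sum_v weight v) + 50 <= k ->
  runs search m0 k (fun m => exists q,
    [/\ search_inv q (size q) [::], queue_mem m q & m 20 0 = size q]).
Proof.
have [T TE] : exists T, T = duration visit_arc + 20 by exists (duration visit_arc + 20).
rewrite -[60]/(20 + 40) addnA -TE; set D := T + 40 => m0_input m0_start le_k.
apply: runs_seq_store => /=; first by move: le_k; clear; lia.
move=> m1 m1E; apply: runs_seq_store => /=; first by move: le_k; clear; lia.
move=> m2 m2E; apply: runs_seq_store => /=; first by move: le_k; clear; lia.
move=> m3 m3E; apply: runs_seq_store => /=; first by move: le_k; clear; lia.
move=> m4 m4E.
pose ws := [:: 9; 10; 20; 21; 22; 23; 24].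
have m4_off : agree_off ws m0 m4.
  move=> y; rewrite !inE !negb_or => /and5P[/negPf y9 /negPf y10 /negPf y20 /negPf y21 _] j.
  by rewrite m4E y21 /= m3E y9 /= m2E y10 /= m1E y20.
have m4_queue : queue_mem m4 [:: u0].
  split=> [|[|//] _|v]; rewrite ?inE.
  - by rewrite m4E.
  - by rewrite m4E /= m3E /= m2E /= m1E /= input_start.
  - move=> /eqP ->; rewrite m4E m3E /= !m2E /= !m1E /= input_start // !eqxx.
    exact: input_vertices.
have m4_i : m4 20 0 = 0 by rewrite m4E /= m3E /= m2E /= m1E.
move: m4 {m1 m1E m2 m2E m3 m3E m4E} m4_off m4_queue m4_i => m4 m4_off m4_queue m4_i.
(* The remaining time is charged to all unexplored vertices, including those not yet discovered. *)
pose J m k := exists q i, [/\ search_inv q i [::], queue_mem m q,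
  m 20 0 = i /\ i <= size q, agree_off ws m0 m &
  D * (\sum_(v | v \notin take i q) weight v) + 10 < k].
apply: (@runs_while _ _ J) => [m {le_k} k [q [i [_ _ _ _]]]|m {le_k} k|m {le_k} k|].
- by rewrite /=; lia.
- case=> q [i [inv_q mem_q [mi le_i] _ _]] /=; have [m21 _ _] := mem_q.
  rewrite mi m21 => /eqP; rewrite eqb0 addn1 -leqNgt => ge_i.
  have iE : i = size q by apply/eqP; rewrite eqn_leq le_i.
  by exists q; split; rewrite // -?iE.
- case=> q [i [inv_q mem_q [mi le_i] m_off le_k]] /=; have [m21 m10 _] := mem_q.
  rewrite mi m21 eqb0 negbK addn1 => lt_i; set u := nth u0 q i.
  have uq : u \in q by apply: mem_nth.
  have q_uniq := search_uniq inv_q.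
  have m_input : has_input m by apply: has_input_agree m_off m0_input.
  have budget_split : \sum_(v | v \notin take i q) weight v =
      weight u + \sum_(v | v \notin take i.+1 q) weight v.
    rewrite (bigD1 u) ?in_take ?index_uniq ?ltnn //=; congr (_ + _).
    apply: eq_bigl => v; rewrite (take_nth u0) // mem_rcons inE negb_or andbC.
    by rewrite -/u.
  rewrite budget_split mulnDr in le_k.
  have D_split : D * weight u = T * weight u + 40 * weight u by rewrite -mulnDl.
  have w_gt0 : 0 < weight u by rewrite /weight; case: ifP.
  exists (D * weight u - 8); first by move: le_k D_split w_gt0; clear; lia.
  apply: runs_seq_store => /=; first by move: D_split w_gt0; clear; lia.
  move=> m1 m1E.
  have m1_off : agree_off ws m m1.
    move=> y; rewrite !inE !negb_or => /and5P[_ _ _ _ /and3P[/negPf y22 _ _]] j.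
    by rewrite m1E y22.
  have m1_22 : agree_off [:: 22] m m1.
    by move=> y; rewrite inE => /negPf y22 j; rewrite m1E y22.
  have m1_u : m1 22 0 = code u by rewrite m1E /= mi m10.
  have m1_input : has_input m1 by apply: has_input_agree m1_22 m_input.
  have m1_queue : queue_mem m1 q by apply: queue_mem_agree m1_22 mem_q.
  pose Q1 m' := exists q', let q1 := q ++ q' in
    search_inv q1 i.+1 [::] /\ queue_mem m' q1.
  apply: (@runs_seq _ _ _ (T * weight u + 9) 8 _ Q1).
  - by move: D_split w_gt0; clear; lia.
  - apply: runs_if => [|/=|/=]; first by rewrite /=; clear; lia.
      rewrite m1_u input_sink // eqb0 negbK => us.
      apply: runs_result => //=; first by clear; lia.
      exists [::]; rewrite cats0; split=> //.
      by apply: search_next => //; rewrite -/u us.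
    rewrite m1_u input_sink // => /eqP; rewrite eqb0 => us.
    apply: (@runs_weaken _ _ (T * weight u)); last first.
    + apply: (@runs_visit_arcs m1 q i) => //.
        by rewrite -/u m1_off // m_off // m0_start.
      by rewrite -/u /weight (negPf us) TE.
    + move=> m' _ [q' [inv1 mem1]]; exists q'; split=> //; apply: search_next.
        by rewrite size_cat ltn_addr.
      by rewrite nth_cat lt_i -/u (negPf us).
    + by clear; lia.
  - move=> m2 m2_off [q' [inv2 mem2]]; apply: runs_result => //.
    have m2_i : m2 20 0 = i by rewrite m2_off // m1_22 // mi.
    have take_q : take i.+1 (q ++ q') = take i.+1 q by rewrite takel_cat.
    exists (q ++ q'), i.+1; rewrite [result _ _]/=; split=> //.
    + by rewrite /update /= m2_i addn1; split=> //; rewrite size_cat ltn_addr.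
    + apply: agree_off_trans m_off _; apply: agree_off_trans m1_off _.
      apply: agree_off_trans (agree_off_sub _ m2_off) _; first exact/allP.
      by apply: (@agree_off_sub [:: 20]); [exact/allP | exact: agree_off_update].
    + rewrite take_q; move: (\sum_(v | v \notin take i.+1 q) weight v) le_k => S.
      by move: w_gt0 D_split; clear; rewrite /=; lia.
- exists [:: u0], 0; split=> //; first last.
    by rewrite /=; move: le_k; rewrite (eq_bigl xpredT) //; clear; lia.
  split=> // [v|a as_ _ [|]//]; rewrite inE => /eqP ->.
  by rewrite eqxx.
Qed.

(** * Bounds on the returns, backwards along the queue *)

Lemma sum_weight_queue q : uniq q -> \sum_(v <- q) weight v <= \sum_v weight v.
Proof.
move=> q_uniq; rewrite big_uniq //= [leqRHS](bigID (mem q)) /=.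
exact: leq_addr.
Qed.

Local Notation children_min := (children_min G u0 par).
Local Notation return_value := (return_value G u0 par start).

Lemma eq_seq_min (N : nat) (p : pred A) (g g' : A -> nat) l :
  (forall a, a \in l -> p a -> g a = g' a) -> seq_min N p g l = seq_min N p g' l.
Proof.
elim/last_ind: l => // l a IHl eq_g; rewrite !seq_min_rcons IHl.
  by case: ifP => // pa; rewrite eq_g // mem_rcons mem_head.
by move=> b bl; apply: eq_g; rewrite mem_rcons inE bl orbT.
Qed.

Lemma eq_children_min F F' l : (forall a, a \in l -> ~~ up_arc a -> F (head a) = F' (head a)) ->
  children_min F l = children_min F' l.
Proof. exact: eq_seq_min. Qed.

Lemma eq_return_value F F' u :
  (forall a, a \in arcs_from u -> ~~ up_arc a -> F (head a) = F' (head a)) ->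
  return_value F u = return_value F' u.
Proof.
move=> eq_F; rewrite /return_value.
congr (minn (if _ then _ + _ else _) _.+1); apply: eq_children_min => // a.
by move=> /mem_take; apply: eq_F.
Qed.

(** Truncated subtraction makes this the minimum. *)
Definition min_expr (e1 e2 : expr) : expr := Bin Defs.Sub e1 (Bin Defs.Sub e1 e2).

(** When the arc to the parent is met, array 12 holds the minimum over the earlier children only, as
    the first term of [return_value] requires. *)
Definition return_arc : cmd :=
  If (Bin Eq (Read 2 (var 23)) (Read 9 (var 22)))
    (Seq (set 25 (Bin Add (Read 12 (var 22))
                          (Bin Mul (Read 4 (var 22)) (Read 0 (Const 0)))))
         (Store 13 (var 22) (Const 0)))
    (Store 12 (var 22) (min_expr (Read 12 (var 22)) (Read 11 (Read 2 (var 23))))).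

(** Register 25 starts at 0, so the stored bound is 0 when no arc to the parent is met. *)
Definition bound_returns : cmd :=
  While (var 20)
    (Seq (set 20 (Bin Defs.Sub (var 20) (Const 1)))
    (Seq (set 22 (Read 10 (var 20)))
         (If (Bin Eq (Read 4 (var 22)) (Const 2)) Skip
            (Seq (Store 12 (var 22) (Read 0 (Const 0)))
            (Seq (Store 13 (var 22) (Read 0 (Const 0)))
            (Seq (set 25 (Const 0))
            (Seq (over_arcs return_arc)
                 (Store 11 (var 22) (min_expr (var 25)
                    (Bin Add (Read 12 (var 22)) (Const 1)))))))))))%N.

Lemma runs_return_arcs m q u k (F := fun v => m 11 (code v)) :
  has_input m -> queue_mem m q -> u \in q -> u \notin sinks G -> m 22 0 = code u ->
  m 8 (code u) = code (start u) ->
  m 12 (code u) = #|V| -> m 13 (code u) = #|V| -> m 25 0 = 0 ->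
  (duration return_arc + 20) * (size (arcs_from u)).+1 <= k ->
  runs (over_arcs return_arc) m k (fun m' => [/\
    m' 12 (code u) = children_min F (arcs_from u),
    m' 13 (code u) = (if has up_arc (arcs_from u) then 0 else #|V|),
    minn (m' 25 0) (m' 12 (code u)).+1 = return_value F u,
    forall v, v != u -> m' 12 (code v) = m 12 (code v) &
    forall v, v != u -> m' 13 (code v) = m 13 (code v)]).
Proof.
move=> m_input mem_q uq us m22 m8 m12 m13 m25 le_k.
pose I l m' := [/\ m' 12 (code u) = children_min F l,
    m' 13 (code u) = (if has up_arc l then 0 else #|V|),
    m' 25 0 = (if has up_arc l
      then children_min F (take (find up_arc l) l) + (u \in maxv G) * #|V| else 0),
    forall v, v != u -> m' 12 (code v) = m 12 (code v) &
    forall v, v != u -> m' 13 (code v) = m 13 (code v)].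
apply: (@runs_weaken _ _ k k (I (arcs_from u))) => [//|m' _ [-> -> -> e12 e13]|].
  by split.
apply: (runs_over_arcs startP (I := I)) => //.
- by move=> a ta; rewrite input_theta // ta.
- move=> l m1 m2 a_m [e1 e2 e3 e4 e5].
  by split; rewrite ?a_m // => v vu; rewrite a_m //; [apply: e4 | apply: e5].
move=> l1 a l2 m1 lE a_m m1_a [e1 e2 e3 e4 e5].
have m1_input : has_input m1 by apply: has_input_agree a_m m_input.
have m1_q : queue_mem m1 q by apply: queue_mem_agree a_m mem_q.
have m1_u : m1 22 0 = code u by rewrite a_m.
have ta : tail a = u.
  by apply/eqP; rewrite -(mem_arcs_from startP) // lE mem_cat mem_head orbT.
have := @parent_test m1 q a m1_input m1_q; rewrite ta => /(_ uq) test.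
have m1_0 : m1 0 0 = #|V| by apply: input_vertices.
rewrite /I /children_min has_rcons; case: (boolP (up_arc a)) test => [up_a|down_a] test.
  (* There is only one arc to the parent, so none was met before and [find] stops at [a]. *)
  have l1_up : ~~ has up_arc l1.
    apply/hasPn => b bl; apply/negP => up_b.
    have tb : tail b = u.
      by apply/eqP; rewrite -(mem_arcs_from startP) // lE mem_cat bl.
    have ba : b = a by apply: (up_arc_uniq G_simple _ up_b up_a); rewrite ta.
    have := orbit_uniq (theta G) (start u); rewrite -/(arcs_from u) lE cat_uniq.
    by case/and3P=> _ /hasPn/(_ a); rewrite mem_head -ba bl => /(_ isT).
  rewrite /= m1_a m1_u test /= seq_min_rcons /= up_a /=.
  have -> : find up_arc (rcons l1 a) = size l1.
    by rewrite -cats1 find_cat (negPf l1_up) /= up_a addn0.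
  rewrite -cats1 take_size_cat // /update /= m1_u m1_0 eqxx e1 input_max //.
  by split=> // v vu; rewrite code_eq (negPf vu); apply: e5.
rewrite /= m1_a m1_u test /= seq_min_rcons /= (negPf down_a) /=.
rewrite /update /= eqxx -minnE e1 input_head // a_m //.
split=> // [|v vu].
  rewrite e3; case: ifP => // l1_up; rewrite -cats1 find_cat l1_up takel_cat //.
  exact: find_size.
by rewrite code_eq (negPf vu); apply: e4.
Qed.

(** Involves array 11 only at [u] and its children, hence survives writes at vertices nearer the
    front of the queue. Arrays 12 and 13 are kept for the budgets. *)
Definition returns_ok (m : memory) (u : V) : Prop :=
  let F v := m 11 (code v) in
  [/\ F u = return_value F u, m 12 (code u) = children_min F (arcs_from u) &
      m 13 (code u) = if has up_arc (arcs_from u) then 0 else #|V|].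

Lemma returns_ok_agree m m' u :
  (forall a, a \in arcs_from u -> ~~ up_arc a ->
     m 11 (code (head a)) = m' 11 (code (head a))) ->
  (forall x, x \in [:: 11; 12; 13] -> m x (code u) = m' x (code u)) ->
  returns_ok m u -> returns_ok m' u.
Proof.
move=> eq_h eq_u [e1 e2 e3]; split; rewrite -eq_u //.
  by rewrite e1; apply: eq_return_value.
by rewrite e2; apply: eq_children_min.
Qed.

(** Parents precede their children in the queue, which makes it an evaluation order for both
    recursions. *)
Lemma child_index q u a : search_inv q (size q) [::] -> u \in q -> u \notin sinks G ->
  a \in arcs_from u -> ~~ up_arc a -> head a \in q /\ index u q < index (head a) q.
Proof.
move=> inv_q uq us; rewrite mem_arcs_from // => /eqP ta down_a.
have [h0 pa] := down_arcP par_adj down_a.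
have hq : head a \in q.
  by apply: (search_closed inv_q); rewrite ?ta // take_size; left.
by have [_ _ + _] := search_par inv_q hq h0; rewrite pa ta.
Qed.

Lemma runs_bound_returns m0 q k : has_input m0 ->
  search_inv q (size q) [::] -> queue_mem m0 q -> m0 20 0 = size q ->
  (forall u, u \notin sinks G -> m0 8 (code u) = code (start u)) ->
  (forall i, m0 11 i = 0) ->
  (duration return_arc + 80) * (\sum_v weight v) + 10 < k ->
  runs bound_returns m0 k (fun m =>
    (forall u, u \in q -> u \notin sinks G -> returns_ok m u) /\
    (forall s, s \in sinks G -> m 11 (code s) = 0)).
Proof.
move=> m0_input inv_q m0_queue m0_i m0_start m0_11.
have [T TE] : exists T, T = duration return_arc + 20 by exists (duration return_arc + 20).
rewrite -[80]/(20 + 60) addnA -TE; set D := T + 60 => le_k.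
have q_uniq := search_uniq inv_q.
pose ws := [:: 11; 12; 13; 20; 22; 23; 24; 25].
pose J m k := exists i, [/\ m 20 0 = i /\ i <= size q, agree_off ws m0 m,
  forall u, u \in q -> u \notin sinks G -> i <= index u q -> returns_ok m u,
  forall s, s \in sinks G -> m 11 (code s) = 0 &
  D * (\sum_(v <- take i q) weight v) + 10 < k].
apply: (@runs_while _ _ J) => [m {le_k} k [i [_ _ _ _]]|m {le_k} k|m {le_k} k|].
- by rewrite /=; lia.
- case=> i [[mi le_i] _ ok_q ok_s _] /=; rewrite mi => i0; split=> // u uq us.
  by apply: ok_q; rewrite ?i0.
- case=> [[|i] [[mi lt_i] m_off ok_q ok_s le_k]] /=; rewrite mi // => _.
  set u := nth u0 q i; have uq : u \in q by apply: mem_nth.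
  have u_index : index u q = i by apply: index_uniq.
  have m_input : has_input m by apply: has_input_agree m_off m0_input.
  have m_queue : queue_mem m q by apply: queue_mem_agree m_off m0_queue.
  have [m21 m10 _] := m_queue.
  rewrite (take_nth u0) // -/u -cats1 big_cat big_seq1 /= mulnDr in le_k.
  have D_split : D * weight u = T * weight u + 60 * weight u by rewrite -mulnDl.
  have w_gt0 : 0 < weight u by rewrite /weight; case: ifP.
  have [S SE] : exists S, S = \sum_(v <- take i q) weight v
    by exists (\sum_(v <- take i q) weight v).
  rewrite -SE in le_k.
  exists (D * weight u - 3); first by move: le_k D_split w_gt0; clear; lia.
  apply: runs_seq_store => /=; first by move: D_split w_gt0; clear; lia.
  move=> m1 m1E; apply: runs_seq_store => /=; first by move: D_split w_gt0; clear; lia.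
  move=> m2 m2E.
  have m2_i : m2 20 0 = i by rewrite m2E /= m1E /= mi subn1.
  have m2_u : m2 22 0 = code u by rewrite m2E /= !m1E /= mi subn1 m10.
  have m2_off : agree_off [:: 20; 22] m m2.
    move=> y; rewrite !inE negb_or => /andP[/negPf y20 /negPf y22] j.
    by rewrite m2E y22 /= m1E y20.
  have m2_input : has_input m2 by apply: has_input_agree m2_off m_input.
  have m2_queue : queue_mem m2 q by apply: queue_mem_agree m2_off m_queue.
  have m2_ws : agree_off ws m0 m2.
    by apply: agree_off_trans m_off _; apply: agree_off_sub _ m2_off; apply/allP.
  apply: runs_if => [|/=|/=]; first by move: D_split w_gt0; rewrite /=; clear; lia.
    rewrite m2_u input_sink // eqb0 negbK => us.
    apply: runs_result => //=; first by move: D_split w_gt0; clear; lia.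
    exists i; split=> //.
    + by split=> //; apply: ltnW.
    + move=> v vq vs; rewrite leq_eqVlt => /predU1P[iv|lt_v].
        by case/negP: vs; rewrite -(nth_index u0 vq) -iv.
      by apply: returns_ok_agree (ok_q v vq vs lt_v) => [a _ _|x x3]; rewrite m2_off //;
        move: x3; rewrite !inE => /or3P[] /eqP ->.
    + by move=> s ss; rewrite m2_off // ok_s.
    + by rewrite -SE; move: le_k D_split w_gt0; clear; lia.
  rewrite m2_u input_sink // => /eqP; rewrite eqb0 => us.
  apply: runs_seq_store => /=; first by move: D_split w_gt0; clear; lia.
  rewrite m2_u input_vertices // => m3 m3E.
  apply: runs_seq_store; first by move: D_split w_gt0; rewrite /=; clear; lia.
  have m3_u : m3 22 0 = code u by rewrite m3E.
  have m3_0 : m3 0 0 = #|V| by rewrite m3E /= input_vertices.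
  move=> m4; rewrite [eval m3 (var 22)]/= m3_u [eval m3 (var 0)]/= m3_0 => m4E.
  apply: runs_seq_store => /=; first by move: D_split w_gt0; clear; lia.
  move=> m5 m5E.
  have m5_other y v : v != u -> y != 25 -> m5 y (code v) = m2 y (code v).
    by move=> vu /negPf y25; rewrite m5E y25 /= m4E /= m3E /= code_eq (negPf vu) !andbF.
  have m5_off : agree_off [:: 12; 13; 25] m2 m5.
    move=> y; rewrite !inE !negb_or => /and3P[/negPf y12 /negPf y13 /negPf y25] j.
    by rewrite m5E y25 /= m4E y13 /= m3E y12.
  have m5_input : has_input m5 by apply: has_input_agree m5_off m2_input.
  have m5_queue : queue_mem m5 q by apply: queue_mem_agree m5_off m2_queue.
  apply: (@runs_seq _ _ _ (T * weight u) 14).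
  - by move: D_split w_gt0; clear; lia.
  - apply: (@runs_return_arcs m5 q u) => //.
    + by rewrite m5E /= m4E /= m3E.
    + by rewrite m5_off // m2_ws // m0_start.
    + by rewrite m5E /= m4E /= m3E /= eqxx.
    + by rewrite m5E /= m4E /= eqxx.
    + by rewrite /weight (negPf us) TE.
  move=> m6 m6_off [e12 e13 eF e12' e13'].
  apply: runs_result => //.
  have m6_u : m6 22 0 = code u by rewrite m6_off // m5E /= m4E /= m3E.
  have m6_11 x : x \notin [:: 12; 13; 20; 22; 23; 24; 25] -> m6 x =1 m x.
    rewrite !inE !negb_or => /and5P[x12 x13 x20 x22 /and3P[x23 x24 x25]] j.
    rewrite m6_off; last by rewrite /= !inE !negb_or x12 x13 x23 x24 x25.
    rewrite m5_off; last by rewrite !inE !negb_or x12 x13 x25.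
    by rewrite m2_off // !inE negb_or x20.
  have m6_F v : m5 11 (code v) = m6 11 (code v) by rewrite m6_off.
  rewrite [result _ _]/= m6_u -minnE addn1 eF.
  set m7 := update _ _ _ _.
  have m7_off : agree_off [:: 11] m6 m7 by apply: agree_off_update.
  have m7_11 v : m7 11 (code v) = if v == u then return_value (fun v => m5 11 (code v)) u
      else m 11 (code v).
    by rewrite /m7 /update /= code_eq; case: eqP => // _; rewrite m6_11.
  (* Vertices from position [i] on have their children strictly behind it, so writing the bound of
     [u] disturbs no equation already established. *)
  have below_u a v : v \in q -> v \notin sinks G -> i <= index v q ->
      a \in arcs_from v -> ~~ up_arc a -> head a != u.
    move=> vq vs le_v av down_a; have [_] := child_index inv_q vq vs av down_a.
    by apply: contraTneq => ->; rewrite u_index -leqNgt.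
  have F_u a : a \in arcs_from u -> ~~ up_arc a ->
      m5 11 (code (head a)) = m7 11 (code (head a)).
    move=> au down_a; rewrite m7_11 (negPf (below_u a u _ _ _ au down_a)) ?u_index //.
    by rewrite m6_F m6_11.
  exists i; split=> //.
  - split; last exact: ltnW.
    by rewrite /m7 /update /= m6_off // m5_off // m2_i.
  - apply: agree_off_trans m2_ws _.
    apply: agree_off_trans (agree_off_sub _ m5_off) _; first exact/allP.
    apply: agree_off_trans (agree_off_sub _ m6_off) _; first exact/allP.
    by apply: agree_off_sub _ m7_off; apply/allP.
  - move=> v vq vs; rewrite leq_eqVlt => /predU1P[iv|lt_v].
      have -> : v = u by rewrite -(nth_index u0 vq) -iv.
      split.
      + by rewrite m7_11 eqxx; apply: eq_return_value.
      + by rewrite m7_off // e12; apply: eq_children_min.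
      + by rewrite m7_off // e13.
    have v_u : v != u by apply: contraTneq lt_v => ->; rewrite u_index ltnn.
    apply: returns_ok_agree (ok_q v vq vs lt_v) => [a av down_a|x].
      by rewrite m7_11 (negPf (below_u a v _ _ _ av down_a)) // ltnW.
    rewrite !inE => /or3P[] /eqP ->.
    + by rewrite m7_11 (negPf v_u).
    + by rewrite m7_off // e12' // m5_other // m2_off.
    + by rewrite m7_off // e13' // m5_other // m2_off.
  - move=> s ss; rewrite m7_11; case: eqP => [su|_]; last exact: ok_s.
    by move: us; rewrite -su ss.
  - by rewrite -SE; move: le_k D_split w_gt0; clear; lia.
- exists (size q); split=> //.
  + by move=> u uq _; rewrite leqNgt index_mem uq.
  + rewrite take_size; apply: leq_ltn_trans le_k; rewrite leq_add2r leq_mul2l.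
    by rewrite sum_weight_queue // orbT.
Qed.

(** * Budgets, forwards along the queue *)

Local Notation earlier_min := (earlier_min G u0 par).
Local Notation budget_value := (budget_value G u0 par start).

(** The budget of a child is stored before its own term enters register 25, so that only strictly
    earlier arcs count. *)
Definition budget_arc : cmd :=
  If (Bin Eq (Read 2 (var 23)) (Read 9 (var 22)))
    (set 25 (min_expr (var 25)
       (Bin Add (Bin Defs.Sub (Read 15 (var 22)) (Const 1))
                (Bin Mul (Read 4 (var 22)) (Read 0 (Const 0))))))
    (Seq (Store 15 (Read 2 (var 23)) (min_expr (var 25)
            (Bin Add (min_expr (Read 12 (var 22))
               (Bin Add (Bin Defs.Sub (Read 15 (var 22)) (Const 1)) (Read 13 (var 22))))
               (Const 1))))
         (set 25 (min_expr (var 25)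
            (Bin Add (Read 11 (Read 2 (var 23)))
                     (Bin Mul (Read 4 (var 22)) (Read 0 (Const 0))))))).

Lemma runs_budget_arcs m q u k (F := fun v : V => m 11 (code v)) (b := m 15 (code u)) :
  has_input m -> queue_mem m q -> u \in q -> u \notin sinks G -> m 22 0 = code u ->
  m 8 (code u) = code (start u) -> returns_ok m u -> 0 < b -> m 25 0 = #|V| ->
  (duration budget_arc + 20) * (size (arcs_from u)).+1 <= k ->
  runs (over_arcs budget_arc) m k (fun m' =>
    (forall a, tail a = u -> ~~ up_arc a ->
       m' 15 (code (head a)) = budget_value F b u a) /\
    (forall v, (forall a, tail a = u -> ~~ up_arc a -> head a != v) ->
       m' 15 (code v) = m 15 (code v))).
Proof.
move=> m_input mem_q uq us m22 m8 [_ m12 m13] b_gt0 m25 le_k.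
pose I l m' := [/\ m' 25 0 = earlier_min F b (u \in maxv G) l,
    forall a, a \in l -> ~~ up_arc a -> m' 15 (code (head a)) = budget_value F b u a &
    forall v, (forall a, tail a = u -> ~~ up_arc a -> head a != v) ->
       m' 15 (code v) = m 15 (code v)].
apply: (@runs_weaken _ _ k k (I (arcs_from u))) => [//|m' _ [_ e1 e2]|].
  by split=> // a ta; apply: e1; rewrite mem_arcs_from // ta.
apply: (runs_over_arcs startP (I := I)) => //.
- by move=> a ta; rewrite input_theta // ta.
- move=> l m1 m2 a_m [e1 e2 e3]; split; rewrite ?a_m // => v.
    by move=> vl dv; rewrite a_m //; apply: e2.
  by move=> hv; rewrite a_m //; apply: e3.
move=> l1 a l2 m1 lE a_m m1_a [e1 e2 e3].
have m1_input : has_input m1 by apply: has_input_agree a_m m_input.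
have m1_q : queue_mem m1 q by apply: queue_mem_agree a_m mem_q.
have m1_u : m1 22 0 = code u by rewrite a_m.
have arcs_tail c : c \in arcs_from u -> tail c = u.
  by rewrite mem_arcs_from // => /eqP.
have ta : tail a = u by apply: arcs_tail; rewrite lE mem_cat mem_head orbT.
have := @parent_test m1 q a m1_input m1_q; rewrite ta => /(_ uq) test.
have m1_0 : m1 0 0 = #|V| by apply: input_vertices.
have m1_b : m1 15 (code u) = b.
  apply: e3 => c tc down_c; have [c0 pc] := down_arcP par_adj down_c.
  by apply: contraTneq (par_depth c0) => hc; rewrite pc tc hc ltnn.
have l_uniq : uniq (l1 ++ a :: l2) by rewrite -lE; apply: orbit_uniq.
have a_l1 : a \notin l1.
  by move: l_uniq; rewrite cat_uniq => /and3P[_ /hasPn/(_ a) + _]; apply; rewrite mem_head.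
rewrite /I /= m1_a m1_u test; have [up_a|down_a] := boolP (up_arc a).
  rewrite /= /update /= m1_b m1_0 input_max // -minnE e1.
  split=> //.
    by rewrite /earlier_min seq_min_rcons /= up_a subn1.
  move=> c; rewrite mem_rcons inE => /predU1P[->|]; last exact: e2.
  by rewrite up_a.
rewrite /= /update /= ?m1_a ?m1_u m1_b m1_0 input_head // input_max //.
rewrite -!minnE e1 (a_m 12) // (a_m 13) // (a_m 11) // m12 m13 addn1 subn1.
split=> [|c|v hv].
- by rewrite /earlier_min seq_min_rcons /= (negPf down_a).
- rewrite code_eq mem_rcons inE => /predU1P[->|c_l1] down_c.
    rewrite eqxx /budget_value eqn0Ngt b_gt0 /= lE.
    by rewrite index_cat (negPf a_l1) /= eqxx addn0 take_size_cat.
  case: eqP => [hca|_]; last exact: e2.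
  have ca : c = a.
    by apply: G_simple => //; rewrite ta; apply: arcs_tail; rewrite lE mem_cat c_l1.
  by rewrite -ca c_l1 in a_l1.
- by rewrite code_eq eq_sym (negPf (hv a ta down_a)); apply: e3.
Qed.

(** A vertex of budget 0 is skipped: its children keep the initial 0, which is what the recursion
    assigns to them. The output is updated as [x + (y - x)], the maximum in truncated arithmetic. *)
Definition spread_budgets : cmd :=
  Seq (Store 15 (Read 0 (Const 2)) (Const 1))
  (Seq (set 20 (Const 0))
       (While (Bin Leq (Bin Add (var 20) (Const 1)) (var 21))
         (Seq (set 22 (Read 10 (var 20)))
         (Seq (If (Read 15 (var 22))
                 (If (Bin Eq (Read 4 (var 22)) (Const 2))
                    (Store 7 (Const 0) (Bin Add (Read 7 (Const 0))
                       (Bin Defs.Sub (Read 5 (var 22)) (Read 7 (Const 0)))))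
                    (Seq (set 25 (Read 0 (Const 0))) (over_arcs budget_arc)))
                 Skip)
              (set 20 (Bin Add (var 20) (Const 1))))))).

Lemma eq_budget_value F F' b u a : F =1 F' ->
  budget_value F b u a = budget_value F' b u a.
Proof.
move=> eq_F; rewrite /budget_value; case: eqP => // _.
congr (minn _ (minn _ _).+1); last by apply: eq_children_min.
by apply: eq_seq_min => c _ _; rewrite eq_F.
Qed.

Lemma runs_spread_budgets m0 q k (F := fun v : V => m0 11 (code v)) : has_input m0 ->
  search_inv q (size q) [::] -> queue_mem m0 q ->
  (forall u, u \notin sinks G -> m0 8 (code u) = code (start u)) ->
  (forall u, u \in q -> u \notin sinks G -> returns_ok m0 u) ->
  (forall i, m0 15 i = 0) -> m0 7 0 = 0 ->
  (duration budget_arc + 80) * (\sum_v weight v) + 20 < k ->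
  runs spread_budgets m0 k (fun m => let B v := m 15 (code v) in
    [/\ B u0 = 1,
        forall a, tail a \in q -> tail a \notin sinks G -> ~~ up_arc a ->
          B (head a) = budget_value F (B (tail a)) (tail a) a &
        output m = \max_(s <- q)
          (if (s \in sinks G) && (0 < B s) then sink_val G s else 0)]).
Proof.
move=> m0_input inv_q m0_queue m0_start m0_ok m0_15 m0_7.
have [T TE] : exists T, T = duration budget_arc + 20 by exists (duration budget_arc + 20).
rewrite -[80]/(20 + 60) addnA -TE; set D := T + 60.
have [W WE] : exists W, W = \sum_v weight v by exists (\sum_v weight v).
rewrite -WE => le_k.
have q_uniq := search_uniq inv_q.
have [q_gt0 q0] := search_root inv_q.
have u0q : u0 \in q by rewrite -{1}q0 mem_nth.
pose ws := [:: 7; 15; 20; 22; 23; 24; 25].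
apply: runs_seq_store => /=; first by move: le_k; clear; lia.
rewrite input_start // => m1 m1E.
apply: runs_seq_store => /=; first by move: le_k; clear; lia.
move=> m2 m2E.
(* The clause on unexplored parents keeps the initial zeros available for the children of skipped
   vertices. *)
pose J m k := exists i, let B v := m 15 (code v) in
  [/\ [/\ m 20 0 = i, i <= size q, agree_off ws m0 m & B u0 = 1],
  forall a, tail a \in take i q -> tail a \notin sinks G -> ~~ up_arc a ->
    B (head a) = budget_value F (B (tail a)) (tail a) a,
  forall v, v \in q -> v != u0 -> par v \notin take i q -> B v = 0,
  m 7 0 = \max_(s <- take i q)
    (if (s \in sinks G) && (0 < B s) then sink_val G s else 0) &
  D * (\sum_(v <- drop i q) weight v) + 10 < k].
apply: (@runs_while _ _ J) => [m {le_k} k [i [_ _ _ _]]|m {le_k} k|m {le_k} k|].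
- by rewrite /=; lia.
- case=> i [[mi le_i m_off B0] B_eq _ out _] /=.
  have [m21 _ _] : queue_mem m q by apply: queue_mem_agree m_off m0_queue.
  rewrite mi m21 => /eqP; rewrite eqb0 addn1 -leqNgt => ge_i.
  have iE : i = size q by apply/eqP; rewrite eqn_leq le_i.
  by rewrite iE take_size in B_eq out.
- case=> i [[mi le_i m_off B0] B_eq B_new out le_k] /=.
  have m_queue : queue_mem m q by apply: queue_mem_agree m_off m0_queue.
  have [m21 m10 _] := m_queue.
  rewrite mi m21 eqb0 negbK addn1 => lt_i.
  set u := nth u0 q i; have uq : u \in q by apply: mem_nth.
  have u_index : index u q = i by apply: index_uniq.
  have u_take : u \notin take i q by rewrite in_take // u_index ltnn.
  have m_input : has_input m by apply: has_input_agree m_off m0_input.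
  rewrite (drop_nth u0) // -/u big_cons mulnDr in le_k.
  have D_split : D * weight u = T * weight u + 60 * weight u by rewrite -mulnDl.
  have w_gt0 : 0 < weight u by rewrite /weight; case: ifP.
  have [S SE] : exists S, S = \sum_(v <- drop i.+1 q) weight v
    by exists (\sum_(v <- drop i.+1 q) weight v).
  rewrite -SE in le_k.
  exists (D * weight u - 8); first by move: le_k D_split w_gt0; clear; lia.
  apply: runs_seq_store => /=; first by move: D_split w_gt0; clear; lia.
  move=> m3 m3E.
  have m3_u : m3 22 0 = code u by rewrite m3E /= mi m10.
  have m3_off : agree_off [:: 22] m m3.
    by move=> y; rewrite inE => /negPf y22 j; rewrite m3E y22.
  have m3_input : has_input m3 by apply: has_input_agree m3_off m_input.
  have m3_queue : queue_mem m3 q by apply: queue_mem_agree m3_off m_queue.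
  have takeE v : (v \in take i.+1 q) = (v == u) || (v \in take i q).
    by rewrite (take_nth u0) // mem_rcons inE.
  pose Q1 m' := let B v := m' 15 (code v) in
    [/\ forall v, (forall a, tail a = u -> u \notin sinks G -> ~~ up_arc a -> head a != v) ->
          B v = m 15 (code v),
        forall a, tail a = u -> u \notin sinks G -> ~~ up_arc a ->
          B (head a) = budget_value F (m 15 (code u)) u a &
        m' 7 0 = maxn (m 7 0)
          (if (u \in sinks G) && (0 < m 15 (code u)) then sink_val G u else 0)].
  apply: (@runs_seq _ _ _ (T * weight u + 30) 8 _ Q1).
  + by move: D_split w_gt0; clear; lia.
  + apply: runs_if => [|/=|/=]; first by rewrite /=; clear; lia.
    * rewrite m3_u m3_off // => Bu; apply: runs_if => [||]; first by rewrite /=; clear; lia.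
        rewrite /= m3_u input_sink // eqb0 negbK => us.
        apply: runs_result => //=; first by clear; lia.
        rewrite /Q1 /update /=; split=> [v _|a _|].
        - by rewrite m3_off.
        - by rewrite us.
        - by rewrite m3_off // m3_u input_val // -maxnE us lt0n Bu.
      rewrite /= m3_u input_sink // => /eqP; rewrite eqb0 => us.
      apply: runs_seq_store => /=; first by clear; lia.
      rewrite input_vertices // => m4 m4E.
      have m4_off : agree_off [:: 25] m3 m4.
        by move=> y; rewrite inE => /negPf y25 j; rewrite m4E y25.
      have m4_m : agree_off (7 :: 15 :: [:: 22; 25]) m m4.
        apply: agree_off_trans (agree_off_sub _ m3_off) _; first exact/allP.
        by apply: agree_off_sub _ m4_off; apply/allP.
      have e15 v : m4 15 (code v) = m 15 (code v) by rewrite m4_off // m3_off.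
      have e11 v : m4 11 (code v) = F v by rewrite m4_m // m_off.
      apply: (@runs_weaken _ _ (T * weight u)); last first.
      - apply: (@runs_budget_arcs m4 q u) => //.
        + exact: has_input_agree m4_off m3_input.
        + exact: queue_mem_agree m4_off m3_queue.
        + by rewrite m4_off.
        + by rewrite m4_m // m_off // m0_start.
        + by apply: returns_ok_agree (m0_ok u uq us) => [a _ _|x]; 
            [rewrite e11 | rewrite !inE => /or3P[] /eqP ->; rewrite m4_m // m_off].
        + by rewrite e15 lt0n.
        + by rewrite /weight (negPf us) TE.
      - move=> m' m'_off [e1 e2]; split=> [v hv|a ta _ down_a|].
        + by rewrite e2 ?e15 // => a ta; apply: hv.
        + by rewrite e1 // e15; apply: eq_budget_value.
        + by rewrite (negPf us) /= maxn0 m'_off // m4_off // m3_off.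
      - by clear; lia.
    * rewrite m3_u m3_off // => Bu; apply: runs_result => //; first by rewrite /=; clear; lia.
      split=> [v _|a ta us down_a|].
      - by rewrite /= m3_off.
      - have [h0 pa] := down_arcP par_adj down_a.
        rewrite /= m3_off // Bu B_new //; last by rewrite pa ta.
        by apply: (search_closed inv_q) => //; rewrite ?ta // take_size; left.
      - by rewrite /= m3_off // Bu andbF maxn0.
  move=> m4 m4_off [B_old B_u out4].
  have m4_i : m4 20 0 = i by rewrite m4_off // m3_off.
  apply: runs_result => //.
  set m5 := result _ _.
  have m5_off : agree_off [:: 20] m4 m5 by apply: agree_off_update.
  have B5 v : m5 15 (code v) = m4 15 (code v) by rewrite m5_off.
  have B_take v : v \in take i.+1 q -> m4 15 (code v) = m 15 (code v).
    move=> v_take; apply: B_old => a ta us down_a.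
    have [|_ lt_h] := child_index (a := a) inv_q uq us _ down_a.
      by rewrite mem_arcs_from // ta.
    apply: contraTneq lt_h => ->; rewrite u_index -leqNgt -ltnS.
    by rewrite -in_take // (mem_take v_take).
  exists i.+1; split.
  + split=> //.
    * by rewrite /m5 /= /update /= m4_i addn1.
    * apply: agree_off_trans m_off _.
      apply: agree_off_trans (agree_off_sub _ m3_off) _; first exact/allP.
      apply: agree_off_trans (agree_off_sub _ m4_off) _; first exact/allP.
      by apply: agree_off_sub _ m5_off; apply/allP.
    * by rewrite B5 B_old // => a _ _ /(down_arcP par_adj)[].
  + move=> a ta_take as_ down_a; rewrite !B5 (B_take _ ta_take).
    have [ta|ta] := eqVneq (tail a) u; first by rewrite ta B_u // -ta.
    rewrite -B_eq //; last by move: ta_take; rewrite takeE (negPf ta).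
    apply: B_old => c tc us down_c; apply: contra_neq ta => hca.
    have [_ pa] := down_arcP par_adj down_a; have [_ pc] := down_arcP par_adj down_c.
    by rewrite -pa -hca pc.
  + move=> v vq v0; rewrite takeE negb_or B5 => /andP[pu p_take].
    rewrite B_old ?B_new // => a ta us /(down_arcP par_adj)[_ pa].
    by apply: contraNneq pu => <-; rewrite pa ta.
  + rewrite m5_off // out4 out (take_nth u0) // -/u -cats1 big_cat big_seq1 /=.
    rewrite B5 B_take; last by rewrite takeE eqxx.
    congr maxn; apply: eq_big_seq => v v_take; rewrite B5 B_take //.
    by rewrite takeE v_take orbT.
  + by rewrite -SE; move: le_k D_split w_gt0; clear; lia.
- exists 0; split=> //.
  + split=> //; first last.
    * by rewrite m2E /= m1E /= eqxx.
    * move=> y; rewrite !inE !negb_or => /and3P[_ /negPf y15 /andP[/negPf y20 _]] j.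
      by rewrite m2E y20 /= m1E y15.
  + by rewrite take0.
  + by move=> v vq v0 _; rewrite m2E /= m1E /= code_eq (negPf v0).
  + by rewrite take0 big_nil m2E /= m1E.
  + rewrite drop0; apply: (@leq_ltn_trans (D * W + 10)).
      by rewrite leq_add2r leq_mul2l WE sum_weight_queue // orbT.
    by move: le_k; clear; lia.
Qed.

(** * The whole program *)

Definition solve : cmd :=
  Seq first_arcs (Seq search (Seq bound_returns spread_budgets)).

(** [202 = 120 + 82]: the first phase takes [40 * #|A|.+1], at most [120 * #|V|], and
    [82 = 50 + 11 + 21] collects the additive constants of the others. The factors 3 come from
    [sum_weight]. *)
Definition solve_rate : nat := 202 + 3 * (duration visit_arc + 60) +
  3 * (duration return_arc + 80) + 3 * (duration budget_arc + 80).

End Algorithm.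

Theorem theorem74 :
  exists (P : cmd) (C : nat),
  forall (V A : finType) (G : game V A) (u0 : V),
    simple G -> tree_like G -> stopping G ->
    exists (t : nat) (m : memory),
      exec P (encode G u0) t m /\
      t <= C * #|V| /\
      output m = val_star G u0.
Proof.
exists solve, solve_rate => V A G u0 G_simple [G_tree _] G_stopping.
have adj_sym : symmetric (adj G) by move=> x y; rewrite /adj orbC.
have adj_irr : irreflexive (adj G).
  move=> x; rewrite /adj orbb; apply/existsP => -[a /andP[/eqP ta /eqP ha]].
  by have := no_loop G a; rewrite ta ha eqxx.
have [par [depth [par_root par_adj0 depth_bound par_adj]]] :=
  tree_parent u0 adj_sym adj_irr G_tree.
have par_depth v : v != u0 -> depth (par v) < depth v by case/par_adj0.
have V_gt0 : 0 < #|V| by apply/card_gt0P; exists u0.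
have A_le := leq_arcs_vertices G_simple par_adj.
have [d1 d1E] : exists d, d = duration visit_arc by exists (duration visit_arc).
have [d2 d2E] : exists d, d = duration return_arc by exists (duration return_arc).
have [d3 d3E] : exists d, d = duration budget_arc by exists (duration budget_arc).
suff: runs solve (encode G u0) (solve_rate * #|V|) (fun m => output m = val_star G u0).
  by case=> t [m [ex le_t out]]; exists t, m.
set m0 := encode G u0.
have m0_input : has_input G u0 m0 by [].
have [K KE] : exists K, K = 3 * #|V| by exists (3 * #|V|).
apply: (@runs_seq _ _ _ (40 * #|A|.+1) ((d1 + 60) * K + 50 +
    ((d2 + 80) * K + 11 + ((d3 + 80) * K + 21)))).
- by rewrite /solve_rate -d1E -d2E -d3E KE; move: V_gt0 A_le; clear; nia.
- exact: (runs_first_arcs G_stopping m0_input _ (leqnn _)).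
move=> m1 m1_off [start startP m1_start].
have W_le : \sum_v weight G start v <= K.
  by rewrite KE; exact: (sum_weight G_simple par_adj startP).
have m1_input : has_input G u0 m1 by apply: has_input_agree m1_off m0_input.
apply: runs_seq (leqnn _) _ _.
  apply: (runs_search G_simple par_adj startP m1_input m1_start).
  by rewrite -d1E leq_add2r leq_mul2l W_le orbT.
move=> m2 m2_off [q [inv_q m2_queue m2_i]].
have m2_input : has_input G u0 m2 by apply: has_input_agree m2_off m1_input.
apply: runs_seq (leqnn _) _ _.
  apply: (runs_bound_returns G_simple par_adj startP m2_input inv_q m2_queue m2_i).
  - by move=> u us; rewrite m2_off // m1_start.
  - by move=> i; rewrite m2_off // m1_off.
  - by rewrite -d2E -addnS leq_add2r leq_mul2l W_le orbT.
move=> m3 m3_off [m3_ok m3_sink].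
have m3_input : has_input G u0 m3 by apply: has_input_agree m3_off m2_input.
have m3_queue : queue_mem u0 par m3 q by apply: queue_mem_agree m3_off m2_queue.
have m3_start u : u \notin sinks G -> m3 8 (code u) = code (start u).
  by move=> us; rewrite m3_off // m2_off // m1_start.
apply: runs_weaken (leqnn _) _ _; last first.
  apply: (runs_spread_budgets G_simple par_depth par_adj startP m3_input inv_q
    m3_queue m3_start m3_ok).
  - by move=> i; rewrite m3_off // m2_off // m1_off.
  - by rewrite m3_off // m2_off // m1_off.
  - by rewrite -d3E -addnS leq_add2r leq_mul2l W_le orbT.
move=> m4 _ [B_root B_eq ->].
have R_reach := search_reach inv_q.
have F_return : return_spec G u0 par (mem q) start (fun v => m3 11 (code v)).
  apply: return_specP => // [s _|u uq us]; first exact: m3_sink.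
  by have [] := m3_ok u uq us.
have B_budget : budget_spec G u0 par (mem q) start
    (fun v => m3 11 (code v)) (fun v => m4 15 (code v)) by apply: budget_specP.
rewrite (val_star_feasible G_simple G_stopping par_root par_depth depth_bound
  par_adj R_reach startP F_return B_budget).
rewrite big_uniq ?(search_uniq inv_q) //= -big_mkcondr.
by apply: eq_bigl => s; rewrite andbCA.
Qed.
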